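(* Let $1\le p,q\le\infty$ with $\frac1p+\frac1q\ge1$, let $X_1,\dots,X_n,Y$ be Banach spaces and let $\beta$ be a reasonable crossnorm on $X_1\otimes\dots\otimes X_n$. Then: (i) $\alpha_{p,q}^\beta$ is a norm on $X_1\otimes\dots\otimes X_n\otimes Y$. (ii) $\alpha_{p,q}^\beta((a-b)\otimes y)\le\beta(a-b)\|y\|$ for all $a,b\in\Sigma_{X_1\dots X_n}$ and $y\in Y$. (iii) Let $\varphi\in\mathcal L^\beta(X_1,\dots,X_n)$ and $y^*\in Y^*$. The linear functional $\varphi\otimes y^*:(X_1\otimes\dots\otimes X_n\otimes Y,\alpha_{p,q}^\beta)\to\mathbb K$ generated by $x^1\otimes\dots\otimes x^n\otimes y\mapsto f_\varphi(x^1\otimes\dots\otimes x^n)\,y^*(y)$ is bounded and $Lip^\beta(f_\varphi)\|y^*\|\le\|\varphi\otimes y^*\|\le\|\varphi\|_\beta\|y^*\|$. (iv) Let $Z_1,\dots,Z_n,W$ be Banach spaces and let $\theta$ be a reasonable crossnorm on $Z_1\otimes\dots\otimes Z_n$. If $R:Z_1\times\dots\times Z_n\to(X_1\otimes\dots\otimes X_n,\beta)$ is a bounded multilinear operator such that its linearization $\widetilde R:(Z_1\otimes\dots\otimes Z_n,\theta)\to(X_1\otimes\dots\otimes X_n,\beta)$ is bounded and $f_R(\Sigma_{Z_1\dots Z_n})\subset\Sigma_{X_1\dots X_n}$, and if $S:W\to Y$ is a bounded linear operator, then the linear map $$R\otimes S:(Z_1\otimes\dots\otimes Z_n\otimes W,\alpha_{p,q}^\theta)\to(X_1\otimes\dots\otimes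 X_n\otimes Y,\alpha_{p,q}^\beta),\qquad z^1\otimes\dots\otimes z^n\otimes w\mapsto f_R(z^1\otimes\dots\otimes z^n)\otimes S(w)$$ is bounded and $\|R\otimes S\|\le\|\widetilde R\|\,\|S\|$.
   Context: All Banach spaces are over the same field $\mathbb K\in\{\mathbb R,\mathbb C\}$; $s^*$ is the conjugate exponent of $s\in[1,\infty]$; $B_X$ is the closed unit ball. A norm $\beta$ on the algebraic tensor product $X_1\otimes\dots\otimes X_n$ is a reasonable crossnorm if $\varepsilon(u)\le\beta(u)\le\pi(u)$ for all $u$, where $\varepsilon$ and $\pi$ are the injective and projective tensor norms. $\Sigma_{X_1\dots X_n}=\{x^1\otimes\dots\otimes x^n:x^i\in X_i\}$, with the metric induced by $\beta$. For a multilinear operator $T$, $\widetilde T$ denotes its linearization and $f_T$ the restriction of $\widetilde T$ to the decomposable tensors: $f_T(x^1\otimes\dots\otimes x^n)=T(x^1,\dots,x^n)$. $Lip^\beta(f_T)$ is the Lipschitz constant of $f_T$ on $\Sigma_{X_1\dots X_n}$ with respect to the metric $\beta(a-b)$. $\mathcal L^\beta(X_1,\dots,X_n)$ is the Banach space of multilinear forms $\varphi$ whose linearization $\widetilde\varphi:(X_1\otimes\dots\otimes X_n,\beta)\to\mathbb K$ is bounded, with norm $\|\varphi\|_\beta=\|\widetilde\varphi\|$. For finite sequences $(a_i),(b_i)$ in $\Sigma_{X_1\dots X_n}$ and $(y_i)$ in $Y$: $\|(a_i-b_i)_{i=1}^m\|_s^{w,\beta}=\sup_{\varphi\in B_{\mathcal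 L^\beta(X_1,\dots,X_n)}}\big(\sum_i|f_\varphi(a_i)-f_\varphi(b_i)|^s\big)^{1/s}$ and $\|(y_i)_{i=1}^m\|_s^w=\sup_{y^*\in B_{Y^*}}\big(\sum_i|y^*(y_i)|^s\big)^{1/s}$ (maxima over $i$ if $s=\infty$). With $r\in[1,\infty]$ determined by $1=\frac1r+\frac1{q^*}+\frac1{p^*}$, define for $u\in X_1\otimes\dots\otimes X_n\otimes Y$ $$\alpha_{p,q}^\beta(u)=\inf\Big\{\|(\lambda_i)_{i=1}^m\|_r\,\|(a_i-b_i)_{i=1}^m\|_{q^*}^{w,\beta}\,\|(y_i)_{i=1}^m\|_{p^*}^w: u=\sum_{i=1}^m\lambda_i(a_i-b_i)\otimes y_i\Big\},$$ the infimum over all representations with $\lambda_i\in\mathbb K$, $a_i,b_i\in\Sigma_{X_1\dots X_n}$, $y_i\in Y$; $\alpha_{p,q}^\theta$ on $Z_1\otimes\dots\otimes Z_n\otimes W$ is defined in the same way from $\theta$. *)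

(* Defs.v *)
From HB Require Import structures.
From mathcomp Require Import all_boot all_order all_algebra.
From mathcomp Require Import all_classical all_reals all_analysis.
From mathcomp Require Import complex lra.

Set Implicit Arguments.
Unset Strict Implicit.
Unset Printing Implicit Defensive.

Import Order.TTheory GRing.Theory Num.Theory.
Import numFieldNormedType.Exports.

Local Open Scope classical_set_scope.
Local Open Scope ring_scope.

Inductive scalar_kind := RealScalars | ComplexScalars.

Definition scalar_field (R : realType) (k : scalar_kind) : numFieldType :=
  match k with RealScalars => R | ComplexScalars => R[i] end.

Definition scalar_re (R : realType) (k : scalar_kind) : scalar_field R k -> R :=
  match k with RealScalars => id | ComplexScalars => @complex.Re R end.

(* The library norm of a [normedModType K] takes its values in [K]; it lies on
   the nonnegative real axis, so its real part carries the whole information. *)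
Definition rnorm (R : realType) (k : scalar_kind)
  (V : normedZmodType (scalar_field R k)) (x : V) : R := scalar_re `|x|.

(* Algebraic tensor product of a family of vector spaces: formal linear
   combinations of families, modulo the least congruence containing the vector
   space axioms and multilinearity of [TPure]. *)
Section Tensor.
Variables (K : fieldType) (I : eqType) (X : I -> lmodType K).

Local Notation upd x y := (@eqtype.dfwith I (fun j => X j : Type) x _ y).

Inductive tterm : Type :=
| TZero
| TAdd of tterm & tterm
| TScale of K & tterm
| TPure of (forall i, X i).

Inductive tcong : tterm -> tterm -> Prop :=
| tcong_refl s : tcong s s
| tcong_sym s t : tcong s t -> tcong t s
| tcong_trans s t u : tcong s t -> tcong t u -> tcong s u
| tcong_add s s' t t' : tcong s s' -> tcong t t' -> tcong (TAdd s t) (TAdd s' t')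
| tcong_scale a s s' : tcong s s' -> tcong (TScale a s) (TScale a s')
| tcong_addA s t u : tcong (TAdd s (TAdd t u)) (TAdd (TAdd s t) u)
| tcong_addC s t : tcong (TAdd s t) (TAdd t s)
| tcong_add0 s : tcong (TAdd TZero s) s
| tcong_addN s : tcong (TAdd (TScale (-1) s) s) TZero
| tcong_scaleA a b s : tcong (TScale a (TScale b s)) (TScale (a * b) s)
| tcong_scale1 s : tcong (TScale 1 s) s
| tcong_scaleDr a s t :
    tcong (TScale a (TAdd s t)) (TAdd (TScale a s) (TScale a t))
| tcong_scaleDl a b s : tcong (TScale (a + b) s) (TAdd (TScale a s) (TScale b s))
| tcong_pureD (x : forall i, X i) i (y z : X i) :
    tcong (TPure (upd x (y + z)))
          (TAdd (TPure (upd x y)) (TPure (upd x z)))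
| tcong_pureZ (x : forall i, X i) i a (y : X i) :
    tcong (TPure (upd x (a *: y))) (TScale a (TPure (upd x y))).

HB.instance Definition _ := gen_eqMixin tterm.
HB.instance Definition _ := gen_choiceMixin tterm.

Definition tcongb (s t : tterm) : bool := `[< tcong s t >].

Lemma tcongb_refl : reflexive tcongb.
Proof. by move=> s; apply/asboolP; exact: tcong_refl. Qed.

Lemma tcongb_sym : symmetric tcongb.
Proof. by move=> s t; apply/asboolP/asboolP; exact: tcong_sym. Qed.

Lemma tcongb_trans : transitive tcongb.
Proof.
by move=> t s u /asboolP st /asboolP tu; apply/asboolP; exact: tcong_trans st tu.
Qed.

Canonical tcong_equiv := EquivRel tcongb tcongb_refl tcongb_sym tcongb_trans.

Definition tensor : Type := {eq_quot tcong_equiv}%qT.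

HB.instance Definition _ := Choice.on tensor.
HB.instance Definition _ := EqQuotient.on tensor.

Definition tproj (t : tterm) : tensor := (\pi_tensor t)%qT.

Lemma tprojP s t : tcong s t <-> tproj s = tproj t.
Proof.
by split=> [st|/eqmodP/asboolP//]; apply/eqmodP/asboolP.
Qed.

Lemma trepr_cong t : tcong (repr (tproj t)) t.
Proof. by apply/tprojP; rewrite /tproj reprK. Qed.

Lemma tproj_ind (P : tensor -> Prop) : (forall t, P (tproj t)) -> forall u, P u.
Proof. by move=> Pt u; rewrite -[u]reprK; exact: Pt. Qed.

Definition tensor_add (u v : tensor) := tproj (TAdd (repr u) (repr v)).
Definition tensor_scale (a : K) (u : tensor) := tproj (TScale a (repr u)).
Definition tensor_opp (u : tensor) := tensor_scale (-1) u.

Lemma tproj_add s t : tensor_add (tproj s) (tproj t) = tproj (TAdd s t).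
Proof. by apply/tprojP/tcong_add; exact: trepr_cong. Qed.

Lemma tproj_scale a s : tensor_scale a (tproj s) = tproj (TScale a s).
Proof. by apply/tprojP/tcong_scale; exact: trepr_cong. Qed.

Lemma tensor_addA : associative tensor_add.
Proof.
elim/tproj_ind=> s; elim/tproj_ind=> t; elim/tproj_ind=> u.
by rewrite !tproj_add; apply/tprojP; exact: tcong_addA.
Qed.

Lemma tensor_addC : commutative tensor_add.
Proof.
elim/tproj_ind=> s; elim/tproj_ind=> t.
by rewrite !tproj_add; apply/tprojP; exact: tcong_addC.
Qed.

Lemma tensor_add0 : left_id (tproj TZero) tensor_add.
Proof.
by elim/tproj_ind=> s; rewrite !tproj_add; apply/tprojP; exact: tcong_add0.
Qed.

Lemma tensor_addN : left_inverse (tproj TZero) tensor_opp tensor_add.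
Proof.
elim/tproj_ind=> s; rewrite /tensor_opp tproj_scale tproj_add.
by apply/tprojP; exact: tcong_addN.
Qed.

HB.instance Definition _ := GRing.isZmodule.Build tensor
  tensor_addA tensor_addC tensor_add0 tensor_addN.

Lemma tensor_scaleA a b u :
  tensor_scale a (tensor_scale b u) = tensor_scale (a * b) u.
Proof.
elim/tproj_ind: u => s; rewrite !tproj_scale.
by apply/tprojP; exact: tcong_scaleA.
Qed.

Lemma tensor_scale1 : left_id 1 tensor_scale.
Proof.
by elim/tproj_ind=> s; rewrite tproj_scale; apply/tprojP; exact: tcong_scale1.
Qed.

Lemma tensor_scaleDr : right_distributive tensor_scale +%R.
Proof.
move=> a; elim/tproj_ind=> s; elim/tproj_ind=> t.
rewrite /GRing.add/= tproj_add !tproj_scale tproj_add.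
by apply/tprojP; exact: tcong_scaleDr.
Qed.

Lemma tensor_scaleDl u : {morph tensor_scale^~ u : a b / a + b >-> a + b}.
Proof.
move=> a b; elim/tproj_ind: u => s.
rewrite [RHS]/GRing.add/= !tproj_scale tproj_add.
by apply/tprojP; exact: tcong_scaleDl.
Qed.

HB.instance Definition _ := GRing.Zmodule_isLmodule.Build K tensor
  tensor_scaleA tensor_scale1 tensor_scaleDr tensor_scaleDl.

Definition pure (x : forall i, X i) : tensor := tproj (TPure x).

Definition multilinear (V : lmodType K) (f : (forall i, X i) -> V) :=
  forall (x : forall i, X i) (i : I) (a : K) (y z : X i),
    f (upd x (a *: y + z)) = a *: f (upd x y) + f (upd x z).

Fixpoint teval (V : lmodType K) (f : (forall i, X i) -> V) (t : tterm) : V :=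
  match t with
  | TZero => 0
  | TAdd s t => teval f s + teval f t
  | TScale a s => a *: teval f s
  | TPure x => f x
  end.

(* Meaningful for multilinear [f] only: see [linz_pure], [linz_linear] and
   [linz_unique]. *)
Definition linz (V : lmodType K) (f : (forall i, X i) -> V) (u : tensor) : V :=
  teval f (repr u).

Lemma teval_cong (V : lmodType K) (f : (forall i, X i) -> V) s t :
  multilinear f -> tcong s t -> teval f s = teval f t.
Proof.
move=> mf; elim=> {s t} //=.
- by move=> s t u _ -> _ ->.
- by move=> s s' t t' _ -> _ ->.
- by move=> a s s' _ ->.
- by move=> s t u; rewrite addrA.
- by move=> s t; rewrite addrC.
- by move=> s; rewrite add0r.
- by move=> s; rewrite scaleN1r addNr.
- by move=> a b s; rewrite scalerA.
- by move=> s; rewrite scale1r.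
- by move=> a s t; rewrite scalerDr.
- by move=> a b s; rewrite scalerDl.
- by move=> x i y z; have := mf x i 1 y z; rewrite !scale1r.
- move=> x i a y; have := mf x i a y 0; rewrite addr0 => ->.
  have := mf x i 1 0 0; rewrite scale1r addr0 scale1r.
  by move/eqP; rewrite -subr_eq0 opprD addNKr oppr_eq0 => /eqP ->; rewrite addr0.
Qed.

Lemma linz_proj (V : lmodType K) (f : (forall i, X i) -> V) t :
  multilinear f -> linz f (tproj t) = teval f t.
Proof. by move=> mf; apply: teval_cong mf _; exact: trepr_cong. Qed.

Lemma pure_multilinear : multilinear pure.
Proof.
move=> x i a y z; rewrite /GRing.add/GRing.scale/= tproj_scale tproj_add.
apply/tprojP; apply: tcong_trans (tcong_pureD _ _ _) _.
by apply: tcong_add (tcong_refl _); exact: tcong_pureZ.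
Qed.

Lemma linz_pure (V : lmodType K) (f : (forall i, X i) -> V) x :
  multilinear f -> linz f (pure x) = f x.
Proof. by move=> mf; rewrite linz_proj. Qed.

Lemma linz_linear (V : lmodType K) (f : (forall i, X i) -> V) :
  multilinear f -> linear (linz f).
Proof.
move=> mf a; elim/tproj_ind=> s; elim/tproj_ind=> t.
rewrite [in LHS]/GRing.add [in LHS]/GRing.scale/= tproj_scale tproj_add.
by rewrite !linz_proj.
Qed.

Lemma linz_unique (V : lmodType K) (f : (forall i, X i) -> V) (g : tensor -> V) :
  multilinear f -> linear g -> (forall x, g (pure x) = f x) -> g = linz f.
Proof.
move=> mf lg gf; apply/funext; elim/tproj_ind=> t; rewrite linz_proj//.
have g0 : g (tproj TZero) = 0.
  have := lg (-1) (tproj TZero) (tproj TZero).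
  by rewrite !scaleN1r !addNr.
have gD s u : g (tproj (TAdd s u)) = g (tproj s) + g (tproj u).
  have := lg 1 (tproj s) (tproj u); rewrite !scale1r => <-.
  by rewrite [in RHS]/GRing.add/= tproj_add.
have gZ a s : g (tproj (TScale a s)) = a *: g (tproj s).
  have := lg a (tproj s) (tproj TZero); rewrite g0 !addr0 => <-.
  by rewrite [in RHS]/GRing.scale/= tproj_scale.
by elim: t => [|s IHs u IHu|a s IHs|x] /=; rewrite ?g0 ?gD ?gZ ?IHs ?IHu -?gf.
Qed.

End Tensor.

(* The binary tensor product, as the tensor product of a [bool]-indexed family. *)
Definition pair_family (K : fieldType) (V W : lmodType K) (b : bool) :
  lmodType K := if b then W else V.

Definition tensor2 (K : fieldType) (V W : lmodType K) : Type :=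
  tensor (pair_family V W).

HB.instance Definition _ (K : fieldType) (V W : lmodType K) :=
  GRing.Lmodule.on (tensor2 V W).

Definition pure2 (K : fieldType) (V W : lmodType K) (v : V) (w : W) :
    tensor2 V W :=
  pure (fun b => if b as b return pair_family V W b then w else v).

Lemma pure2_linearl (K : fieldType) (V W : lmodType K) (w : W) :
  linear (fun v : V => pure2 v w).
Proof.
move=> a y z; pose x b : pair_family V W b :=
  if b as b return pair_family V W b then w else 0.
have E (v : V) : pure2 v w =
    pure (@eqtype.dfwith bool (fun j => pair_family V W j : Type) x false v).
  congr pure; apply: functional_extensionality_dep => -[].
    by rewrite dfwith_out.
  by rewrite dfwith_in.
by rewrite !E; exact: pure_multilinear.
Qed.

Lemma pure2_linearr (K : fieldType) (V W : lmodType K) (v : V) :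
  linear (fun w : W => pure2 v w).
Proof.
move=> a y z; pose x b : pair_family V W b :=
  if b as b return pair_family V W b then 0 else v.
have E (w : W) : pure2 v w =
    pure (@eqtype.dfwith bool (fun j => pair_family V W j : Type) x true w).
  congr pure; apply: functional_extensionality_dep => -[].
    by rewrite dfwith_in.
  by rewrite dfwith_out.
by rewrite !E; exact: pure_multilinear.
Qed.

Lemma linear_multilinear (K : fieldType) (I : eqType) (X : I -> lmodType K)
    (V : lmodType K) (F : tensor X -> V) :
  linear F -> multilinear (fun x => F (pure x)).
Proof. by move=> lF x i a y z; rewrite pure_multilinear lF. Qed.

Lemma tensor_ext (K : fieldType) (I : eqType) (X : I -> lmodType K)
    (V : lmodType K) (F G : tensor X -> V) :
  linear F -> linear G -> (forall x, F (pure x) = G (pure x)) -> F = G.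
Proof.
move=> lF lG FG; have mG := linear_multilinear lG.
rewrite (linz_unique mG lF FG); apply/esym.
exact: linz_unique mG lG (fun=> erefl).
Qed.

(* A linear map on (X_1 (x) ... (x) X_n) (x) Y is determined by its values on
   the tensors x^1 (x) ... (x) x^n (x) y. *)
Lemma tensor2_ext (K : fieldType) (I : eqType) (X : I -> lmodType K)
    (Y V : lmodType K) (F G : tensor2 (tensor X) Y -> V) :
  linear F -> linear G ->
  (forall x y, F (pure2 (pure x) y) = G (pure2 (pure x) y)) -> F = G.
Proof.
move=> lF lG FG; apply: tensor_ext => // x.
have -> : pure x = pure2 (x false) (x true).
  by congr pure; apply: functional_extensionality_dep => -[].
have H : (fun u => F (pure2 u (x true))) = (fun u => G (pure2 u (x true))).
  by apply: tensor_ext => // a u v; rewrite pure2_linearl ?lF ?lG.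
exact: (congr1 (@^~ (x false)) H).
Qed.

Section Norms.
Variables (R : realType) (K : numFieldType).

Definition bounded_op (V W : lmodType K) (N : V -> R) (M : W -> R)
  (f : V -> W) := exists C : R, forall v, M (f v) <= C * N v.

Definition opnorm (V W : lmodType K) (N : V -> R) (M : W -> R)
  (f : V -> W) : R := sup [set M (f v) | v in [set v | N v <= 1]].

(* The norm of [R ^ m] with exponent [s] in [1, +oo], on nonnegative
   sequences; the value at [-oo] is irrelevant. *)
Definition lnorm (s : \bar R) (m : nat) (a : 'I_m -> R) : R :=
  match s with
  | s%:E => (\sum_(i < m) a i `^ s) `^ s^-1
  | +oo%E => \big[Order.max/0]_(i < m) a i
  | -oo%E => 0
  end.

(* [r] such that 1 = 1/r + 1/q* + 1/p*: see [rexpP]. *)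
Definition rexp (p q : \bar R) : \bar R :=
  ((1 - (hoelder_conjugate q)^-1 - (hoelder_conjugate p)^-1)^-1)%E.

Lemma inve_fin_ge1 (s : \bar R) : (1 <= s)%E ->
  exists2 x : R, 0 <= x <= 1 & (s^-1)%E = x%:E.
Proof.
case: s => [s||]//=; rewrite ?lee_fin.
  move=> s1; have s0 : 0 < s by rewrite (lt_le_trans ltr01).
  exists s^-1; last by rewrite inver gt_eqF.
  by rewrite invr_ge0 ltW// invf_le1.
by move=> _; exists 0; rewrite ?lexx ?ler01// invey.
Qed.

Lemma rexpP (p q : \bar R) :
    (1 <= p)%E -> (1 <= q)%E -> (1 <= p^-1 + q^-1)%E ->
  (1 <= rexp p q)%E /\
  ((rexp p q)^-1 + (hoelder_conjugate q)^-1 + (hoelder_conjugate p)^-1 = 1)%E.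
Proof.
have conj (s : \bar R) : (1 <= s)%E ->
    (s^-1 + (hoelder_conjugate s)^-1 = 1)%E.
  move=> s1; have s0 : (0 < s)%E by rewrite (lt_le_trans _ s1)// lte01.
  by apply/hoelder_conjugateP => //; rewrite ?(lt_trans _ s0)// gt_eqF.
move=> p1 q1; have := conj _ p1; have := conj _ q1; rewrite /rexp.
have [x /andP[x0 x1] ->] := inve_fin_ge1 p1.
have [y /andP[y0 y1] ->] := inve_fin_ge1 q1.
have [x' /andP[x'0 x'1] ->] := inve_fin_ge1 (hoelder_conj_ge1 p1).
have [y' /andP[y'0 y'1] ->] := inve_fin_ge1 (hoelder_conj_ge1 q1).
rewrite -!EFinD lee_fin => -[yy] [xx] xy.
have z0 : 0 <= 1 - y' - x' by lra.
have z1 : 1 - y' - x' <= 1 by lra.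
rewrite inver; case: ifPn => [/eqP z|zN0].
  by rewrite invey leey -!EFinD; split=> //; congr EFin; lra.
rewrite inver invr_eq0 (negbTE zN0) invrK -!EFinD lee_fin.
have zp : 0 < 1 - y' - x' by rewrite lt_neqAle eq_sym zN0.
by split; [rewrite invf_ge1|congr EFin; lra].
Qed.

End Norms.

Section Crossnorms.
Variables (R : realType) (k : scalar_kind).
Local Notation K := (scalar_field R k).

Definition is_norm (V : lmodType K) (N : V -> R) :=
  [/\ forall v, 0 <= N v,
      forall v, N v = 0 -> v = 0,
      forall (a : K) v, N (a *: v) = rnorm a * N v &
      forall v w, N (v + w) <= N v + N w].

Definition dual_bounded (V : lmodType K) (N : V -> R) (f : V -> K^o) :=
  bounded_op N (fun z : K^o => rnorm z) f.

Definition dual_norm (V : lmodType K) (N : V -> R) (f : V -> K^o) : R :=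
  opnorm N (fun z : K^o => rnorm z) f.

Definition dual_ball (V : normedModType K) : set {linear V -> K^o} :=
  [set f | dual_bounded (@rnorm R k V) f /\ dual_norm (@rnorm R k V) f <= 1].

Section Family.
Variables (n : nat) (X : 'I_n -> completeNormedModType K).
Local Notation XX := (tensor X).

Definition Sigma : set XX := range (@pure K 'I_n X).

Definition injective_norm (u : XX) : R :=
  sup [set rnorm (linz (fun x : forall i, X i => \prod_(i < n) f i (x i) : K^o) u)
      | f in [set f : forall i, {linear X i -> K^o} |
              forall i, dual_ball (f i)]].

Definition projective_norm (u : XX) : R :=
  inf [set t | exists m (x : 'I_m -> forall i, X i),
         u = \sum_(j < m) pure (x j) /\
         t = \sum_(j < m) \prod_(i < n) rnorm (x j i)].

Definition reasonable_crossnorm (beta : XX -> R) :=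
  is_norm beta /\
  forall u, injective_norm u <= beta u /\ beta u <= projective_norm u.

Variable beta : XX -> R.

(* The space L^beta(X_1, ..., X_n) and its norm. *)
Definition Lbeta : set ((forall i, X i) -> K^o) :=
  [set phi | multilinear phi /\ dual_bounded beta (linz phi)].

Definition Lbeta_norm (phi : (forall i, X i) -> K^o) : R :=
  dual_norm beta (linz phi).

(* Lip^beta(f_phi): the least Lipschitz constant on [Sigma]. *)
Definition Lip (phi : (forall i, X i) -> K^o) : R :=
  inf [set L | 0 <= L /\ forall a b, Sigma a -> Sigma b ->
         rnorm (linz phi a - linz phi b) <= L * beta (a - b)].

Definition weak_norm_Sigma (s : \bar R) (m : nat) (a b : 'I_m -> XX) : R :=
  sup [set lnorm s (fun i => rnorm (linz phi (a i) - linz phi (b i)))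
      | phi in Lbeta `&` [set phi | Lbeta_norm phi <= 1]].

Variable Y : completeNormedModType K.

Definition weak_norm (s : \bar R) (m : nat) (y : 'I_m -> Y) : R :=
  sup [set lnorm s (fun i => rnorm (f (y i))) | f in @dual_ball Y].

Definition alpha (p q : \bar R) (u : tensor2 XX Y) : R :=
  inf [set t | exists m (lam : 'I_m -> K) (a b : 'I_m -> XX) (y : 'I_m -> Y),
         [/\ forall i, Sigma (a i) /\ Sigma (b i),
             u = \sum_(i < m) lam i *: pure2 (a i - b i) (y i) &
             t = lnorm (rexp p q) (fun i => rnorm (lam i))
                 * weak_norm_Sigma (hoelder_conjugate q) a b
                 * weak_norm (hoelder_conjugate p) y]].

End Family.
End Crossnorms.

(* Main.v *)
Require Import Defs.
From HB Require Import structures.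
From mathcomp Require Import all_boot all_order all_algebra.
From mathcomp Require Import all_classical all_reals all_analysis.
From mathcomp Require Import complex.
From mathcomp Require Import ring lra.

Set Implicit Arguments.
Unset Strict Implicit.
Unset Printing Implicit Defensive.

Import Order.TTheory GRing.Theory Num.Theory.
Import numFieldNormedType.Exports.

Local Open Scope classical_set_scope.
Local Open Scope ring_scope.

(* Every bound on alpha comes from the Hoelder inequality with the exponents
   r, q', p' (q' and p' conjugate to q and p), applied to a representation whose
   three factors can be rescaled at will, because Sigma is stable under scalar
   multiplication.  Rescaling so that the factors are t^(1/r), t^(1/q'), t^(1/p')
   makes the bounds on the s-th powers additive under concatenation, whence the
   triangle inequality.  If alpha(u) = 0, then Hoelder gives (phi (x) f)(u) = 0
   for all functionals phi on (X_1 (x) ... (x) X_n, beta) and f on Y that are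
   bounded; by Hahn-Banach these separate points, hence so do their products and
   u = 0. *)

(** * Real and complex scalars *)

Section Scalars.
Variables (R : realType) (k : scalar_kind).
Local Notation K := (scalar_field R k).

(** Degenerate cases shape the estimates. A factor of a representation may vanish, and then nothing
    can be normalised by it; so the three factors are first replaced by larger, strictly positive
    ones whose product stays below a prescribed strict bound. An exponent may be infinite; the
    estimates are therefore phrased with reciprocal exponents, where [+oo] becomes the weight 0 and
    [t^0 = 1], and a weighted AM-GM inequality with weights 1/r, 1/q', 1/p' treats all cases at
    once.

    The real-valued [sup] and [inf] mean what they should only on nonempty bounded sets. Each
    supremum or infimum is therefore traded early for a family of inequalities, which survives
    rescaling, concatenation and composition.

    Both scalar fields are handled together: norms are real numbers, real scalars act through
    [of_real], and Hahn-Banach is proved for real functionals, with complexification as a last step.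
    Separation on the last tensor product is purely algebraic, by induction on the number of terms
    of a tensor. *)

Definition of_real : R -> K :=
  match k return R -> scalar_field R k with
  | RealScalars => id
  | ComplexScalars => fun r => Complex r 0
  end.

Lemma of_realD r s : of_real (r + s) = of_real r + of_real s.
Proof.
rewrite /of_real; case: k => //=.
exact: (raddfD (@real_complex_def R (Phant R))).
Qed.

Lemma of_realM r s : of_real (r * s) = of_real r * of_real s.
Proof.
rewrite /of_real; case: k => //=.
exact: (rmorphM (@real_complex_def R (Phant R))).
Qed.

Lemma of_real1 : of_real 1 = 1.
Proof. by rewrite /of_real; case: k. Qed.

Lemma of_realN r : of_real (- r) = - of_real r.
Proof.
rewrite /of_real; case: k => //=.
exact: (raddfN (@real_complex_def R (Phant R))).
Qed.

Lemma re_of_real r : scalar_re (of_real r) = r.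
Proof. by rewrite /of_real; case: k. Qed.

Lemma ge0_of_re (z : K) : 0 <= z -> of_real (scalar_re z) = z.
Proof.
rewrite /of_real; case: k z => //= -[a b] z0.
by rewrite (ger0_Im z0 : b = 0).
Qed.

Lemma scalar_reD (x y : K) : scalar_re (x + y) = scalar_re x + scalar_re y.
Proof. by case: k x y => //= -[a b] [c d]. Qed.

Lemma scalar_re_le (x y : K) : x <= y -> scalar_re x <= scalar_re y.
Proof. by case: k x y => //= -[a b] [c d]; rewrite lecE => /andP[]. Qed.

Lemma of_real_norm r : `|of_real r| = of_real `|r|.
Proof.
rewrite /of_real; case: k => //=.
by rewrite normc_def /= expr0n addr0 sqrtr_sqr.
Qed.

Lemma rnormE (V : normedZmodType K) (x : V) : of_real (rnorm x) = `|x|.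
Proof. exact: ge0_of_re (normr_ge0 x). Qed.

Lemma of_real_inj : injective of_real.
Proof. by move=> r s /(congr1 (@scalar_re R k)); rewrite !re_of_real. Qed.

Lemma of_real0 : of_real 0 = 0.
Proof. by rewrite /of_real; case: k. Qed.

Lemma scalar_re0 : scalar_re (0 : K) = 0.
Proof. by rewrite -of_real0 re_of_real. Qed.

Lemma rnorm_ge0 (V : normedZmodType K) (x : V) : 0 <= rnorm x.
Proof. by rewrite /rnorm -scalar_re0; apply: scalar_re_le; exact: normr_ge0. Qed.

Lemma rnormD (V : normedZmodType K) (x y : V) :
  rnorm (x + y) <= rnorm x + rnorm y.
Proof. by rewrite /rnorm -scalar_reD; apply: scalar_re_le; exact: ler_normD. Qed.

Lemma rnormN (V : normedZmodType K) (x : V) : rnorm (- x) = rnorm x.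
Proof. by rewrite /rnorm normrN. Qed.

Lemma rnorm0 (V : normedZmodType K) : rnorm (0 : V) = 0.
Proof. by rewrite /rnorm normr0 scalar_re0. Qed.

Lemma rnorm0_eq0 (V : normedZmodType K) (x : V) : rnorm x = 0 -> x = 0.
Proof.
by move=> /(congr1 of_real); rewrite rnormE of_real0 => /eqP; rewrite normr_eq0 => /eqP.
Qed.

Lemma rnormM (a b : K) : rnorm (a * b) = rnorm a * rnorm b.
Proof. by apply: of_real_inj; rewrite of_realM !rnormE normrM. Qed.

Lemma rnorm1 : rnorm (1 : K) = 1.
Proof. by apply: of_real_inj; rewrite rnormE normr1 of_real1. Qed.

Lemma rnormZ (V : normedModType K) (a : K) (x : V) :
  rnorm (a *: x) = rnorm a * rnorm x.
Proof. by apply: of_real_inj; rewrite of_realM !rnormE normrZ. Qed.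

Lemma rnorm_of_real r : rnorm (of_real r) = `|r|.
Proof. by rewrite /rnorm of_real_norm re_of_real. Qed.

Lemma rnorm_sum (V : normedZmodType K) (I : Type) (s : seq I) (P : pred I)
    (F : I -> V) :
  rnorm (\sum_(i <- s | P i) F i) <= \sum_(i <- s | P i) rnorm (F i).
Proof.
elim/big_rec2: _ => [|i y x _ xy]; first by rewrite rnorm0.
by apply: le_trans (rnormD _ _) _; rewrite lerD2l.
Qed.

Lemma rnorm_is_norm (V : normedModType K) : is_norm (@rnorm R k V).
Proof.
by split=> *; [exact: rnorm_ge0|exact: rnorm0_eq0|exact: rnormZ|exact: rnormD].
Qed.

End Scalars.

(** * Separation by bounded functionals *)

Section HahnBanach.
Variables (R : realType) (k : scalar_kind).
Local Notation K := (scalar_field R k).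
Local Notation "r %:K" := (@of_real R k r) (at level 2, format "r %:K").

Variable V : lmodType K.
Implicit Types p q : V -> R.

(** Homogeneity is only an inequality for [r > 0], which passes to infima directly; applying it to
    the inverse of [r] recovers equality. *)
Definition sublinear p :=
  (forall x y, p (x + y) <= p x + p y) /\
  (forall r x, 0 < r -> p (r%:K *: x) <= r * p x).

Lemma sublinear_scale p r x : sublinear p -> 0 < r -> p (r%:K *: x) = r * p x.
Proof.
move=> [_ pZ] r0; apply/eqP; rewrite eq_le pZ//= -ler_pdivlMl//.
apply: le_trans (pZ _ _ _); rewrite ?invr_gt0//.
by rewrite scalerA -of_realM mulVf ?gt_eqF// of_real1 scale1r.
Qed.

Lemma sublinear0 p : sublinear p -> p 0 = 0.
Proof.
move=> sp; have := @sublinear_scale _ 2%:R 0 sp (ltr0n _ 2).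
by rewrite scaler0 => h; lra.
Qed.

Lemma sublinear_lb p x : sublinear p -> - p (- x) <= p x.
Proof.
by move=> sp; have := sp.1 x (- x); rewrite subrr sublinear0// => h; lra.
Qed.

(** The auxiliary functional of the minimal-element proof of Hahn-Banach: it lies below [p], and the
    choice [t = 1] at [x = - y] gives a value at most [- p y]. The infimum is finite, bounded below
    by [- p (- x)]. *)
Definition shift p (y x : V) : R :=
  inf [set p (x + t%:K *: y) - t * p y | t in [set t | 0 <= t]].

Lemma shift_lb p y x t : sublinear p -> 0 <= t ->
  - p (- x) <= p (x + t%:K *: y) - t * p y.
Proof.
move=> sp; rewrite le_eqVlt => /orP[/eqP<-|t0].
  by rewrite of_real0 scale0r addr0 mul0r subr0 sublinear_lb.
have := sp.1 (x + t%:K *: y) (- x).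
by rewrite addrAC subrr add0r sublinear_scale// => h; lra.
Qed.

Lemma shift_le p y x t : sublinear p -> 0 <= t ->
  shift p y x <= p (x + t%:K *: y) - t * p y.
Proof.
move=> sp t0; apply: ge_inf; last by exists t.
by exists (- p (- x)) => _ [s s0 <-]; exact: shift_lb.
Qed.

Lemma le_shift p y x c :
  (forall t, 0 <= t -> c <= p (x + t%:K *: y) - t * p y) -> c <= shift p y x.
Proof.
move=> h; apply: lb_le_inf; last by move=> _ [s s0 <-]; exact: h.
by exists (p (x + 0%:K *: y) - 0 * p y); exists 0 => /=.
Qed.

(** Parameters combine: [t] for [x] and [s] for [x'] give [t + s] for the sum, and [t] for [x] gives
    [r * t] for the multiple of [x] by [r]. *)
Lemma shift_sublinear p y : sublinear p -> sublinear (shift p y).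
Proof.
move=> sp; split=> [x x'|r x r0].
  rewrite -lerBlDr; apply: le_shift => t t0; rewrite lerBlDr -lerBlDl.
  apply: le_shift => s s0.
  have := shift_le y (x + x') sp (addr_ge0 t0 s0).
  have := sp.1 (x + t%:K *: y) (x' + s%:K *: y).
  by rewrite of_realD scalerDl addrACA => h1 h2; lra.
rewrite -ler_pdivrMl//; apply: le_shift => t t0; rewrite ler_pdivrMl//.
have := shift_le y (r%:K *: x) sp (mulr_ge0 (ltW r0) t0).
by rewrite of_realM -scalerA -scalerDr (sublinear_scale _ sp r0) => h; lra.
Qed.

Lemma shift_le_id p y x : sublinear p -> shift p y x <= p x.
Proof.
move=> sp; have := shift_le y x sp (lexx 0).
by rewrite of_real0 scale0r addr0 mul0r subr0.
Qed.

(* Replacing [q] by [shift q y] does not change a minimal [q], which forces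
   [q (x + y) = q x + q y]. *)
Lemma minimal_sublinear_additive q : sublinear q ->
  (forall q', sublinear q' -> (forall x, q' x <= q x) -> q' = q) ->
  forall x y, q (x + y) = q x + q y.
Proof.
move=> sq qmin x y; apply/eqP; rewrite eq_le sq.1 /=.
rewrite -{1}(qmin _ (shift_sublinear y sq) (fun x => shift_le_id y x sq)).
have := shift_le y x sq (@ler01 R).
by rewrite of_real1 scale1r mul1r => h; lra.
Qed.

(** Zorn's lemma for the reversed pointwise order. A nonempty chain is bounded by its pointwise
    infimum, which is finite since every member at [x] is at least [- p (- x)]. *)
Lemma minimal_sublinear_exists p : sublinear p ->
  exists q, [/\ sublinear q, forall x, q x <= p x &
   forall q', sublinear q' -> (forall x, q' x <= q x) -> q' = q].
Proof.
move=> sp; pose T := {q : V -> R | sublinear q /\ forall x, q x <= p x}.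
pose rel (s t : T) := `[< forall x, sval t x <= sval s x >].
have [||||[q [sq qp]] qm] := @Zorn T rel.
- by move=> t; apply/asboolP => x.
- move=> r s t /asboolP rs /asboolP st; apply/asboolP => x.
  exact: le_trans (st x) (rs x).
- move=> [s hs] [t ht] /asboolP/= st /asboolP/= ts; apply: eq_exist.
  by apply/funext => x; apply/eqP; rewrite eq_le st ts.
- move=> A Atot; have [[t0 At0]|A0] := pselect (A !=set0); last first.
    by exists (exist _ p (conj sp (fun x => lexx _))) => s As; case: A0; exists s.
  pose m x := inf [set sval t x | t in A].
  have lbA x : lbound [set sval t x | t in A] (- p (- x)).
    move=> _ [[t [st tp]] At <-] /=; apply: le_trans (sublinear_lb _ st).
    by rewrite lerN2.
  have mle t x : A t -> m x <= sval t x.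
    by move=> At; apply: ge_inf; [exists (- p (- x)); exact: lbA|exists t].
  have lem c x : (forall t, A t -> c <= sval t x) -> c <= m x.
    move=> h; apply: lb_le_inf; first by exists (sval t0 x); exists t0.
    by move=> _ [t At <-]; exact: h.
  have sm : sublinear m.
    split=> [x y|r x r0].
      rewrite -lerBlDr; apply: (lem _ x) => t At; rewrite lerBlDr -lerBlDl.
      apply: (lem _ y) => s As; rewrite lerBlDl.
      (* Of the two members [t] and [s], the smaller one estimates the infimum at [x + y], and its
         values at [x] and [y] lie below [t x] and [s y]. *)
      have [/asboolP st|/asboolP st] := Atot _ _ At As.
        apply: le_trans (mle _ _ As) _; apply: le_trans ((svalP s).1.1 x y) _.
        by rewrite lerD2r.
      apply: le_trans (mle _ _ At) _; apply: le_trans ((svalP t).1.1 x y) _.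
      by rewrite lerD2l.
    rewrite -ler_pdivrMl//; apply: lem => t At; rewrite ler_pdivrMl//.
    exact: le_trans (mle _ _ At) ((svalP t).1.2 _ _ r0).
  have mp x : m x <= p x by apply: le_trans (mle _ _ At0) ((svalP t0).2 x).
  exists (exist _ m (conj sm mp)) => s As; apply/asboolP => x /=; exact: mle.
exists q; split=> // q' sq' q'q.
have q'p x : q' x <= p x := le_trans (q'q x) (qp x).
have := qm (exist _ q' (conj sq' q'p)); rewrite /rel => /(_ _)/(congr1 sval)/= -> //.
by apply/asboolP.
Qed.

(* Zorn is started at [shift p x0], whose value at [- x0] is at most [- p x0];
   this forces [g x0] to be large. *)
Lemma real_functional_exists p x0 : sublinear p -> exists g : V -> R,
  [/\ forall x y, g (x + y) = g x + g y,
      forall r x, g (r%:K *: x) = r * g x,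
      forall x, g x <= p x & p x0 <= g x0].
Proof.
move=> sp.
have [q [sq qp qmin]] := minimal_sublinear_exists (shift_sublinear x0 sp).
have qD := minimal_sublinear_additive sq qmin.
have qN x : q (- x) = - q x.
  by have := qD x (- x); rewrite subrr sublinear0// => h; lra.
exists q; split=> //.
- move=> r x; have [r0|r0|->] := ltrgtP r 0.
  + have := @sublinear_scale q (- r) x sq; rewrite oppr_gt0 => /(_ r0).
    by rewrite of_realN scaleNr qN => h; lra.
  + exact: sublinear_scale.
  + by rewrite of_real0 scale0r mul0r sublinear0.
- by move=> x; apply: le_trans (qp x) (shift_le_id _ _ sp).
- have := qp (- x0); have := shift_le x0 (- x0) sp (@ler01 R).
  by rewrite of_real1 scale1r addNr sublinear0// qN => h1 h2; lra.
Qed.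

End HahnBanach.

Section LinearPredicate.
Variables (K : fieldType) (V W : lmodType K) (f : V -> W).
Hypothesis lf : linear f.

Lemma linear_at0 : f 0 = 0.
Proof. by have := lf (-1) 0 0; rewrite !scaleN1r !addNr. Qed.

Lemma linear_atZ a v : f (a *: v) = a *: f v.
Proof. by have := lf a v 0; rewrite linear_at0 !addr0. Qed.

Lemma linear_atB u v : f (u - v) = f u - f v.
Proof. by rewrite addrC -scaleN1r lf scaleN1r addrC. Qed.

Lemma linear_at_sum (I : Type) (s : seq I) (G : I -> V) :
  f (\sum_(i <- s) G i) = \sum_(i <- s) f (G i).
Proof.
elim: s => [|i s IH]; first by rewrite !big_nil linear_at0.
by rewrite !big_cons -IH; have := lf 1 (G i) (\sum_(j <- s) G j); rewrite !scale1r.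
Qed.

End LinearPredicate.

Section SeparatingFunctionals.
Variables (R : realType).

Lemma rnorm_complex (a b : R) :
  rnorm (Complex a b : scalar_field R ComplexScalars) =
  Num.sqrt (a ^+ 2 + b ^+ 2).
Proof. by have /(congr1 (@complex.Re R)) := normc_def (Complex a b). Qed.

Lemma is_norm_sublinear (k : scalar_kind) (V : lmodType (scalar_field R k))
  (N : V -> R) : is_norm N -> sublinear N.
Proof.
move=> [_ _ NZ ND]; split=> // r x r0.
by rewrite NZ rnorm_of_real gtr0_norm.
Qed.

(** The real functional [g] dominated by [N] satisfies [N x0 <= g x0], so it is positive at [x0],
    and the symmetry of [N] turns domination into [|g| <= N]. Only the passage to complex scalars
    remains. *)
Lemma norm_separates (k : scalar_kind) (V : lmodType (scalar_field R k))
    (N : V -> R) (x0 : V) : is_norm N -> x0 <> 0 ->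
  exists f : V -> (scalar_field R k)^o,
    [/\ linear f, dual_bounded N f & f x0 <> 0].
Proof.
move=> nN x0N.
have [g [gD gZ gN gx0]] := real_functional_exists x0 (is_norm_sublinear nN).
have Nx0 : 0 < g x0.
  case: (nN) => N0 N00 _ _; apply: lt_le_trans gx0; rewrite lt_neqAle N0 andbT.
  by apply/eqP => /esym/N00.
have absg x : `|g x| <= N x.
  have gNx : g (- x) = - g x.
    by have := gZ (-1) x; rewrite of_realN of_real1 scaleN1r mulN1r.
  rewrite ler_norml gN andbT lerNl -gNx; apply: le_trans (gN _) _.
  case: (nN) => _ _ NZ _; have := NZ (-1) x; rewrite scaleN1r => ->.
  by rewrite rnormN rnorm1 mul1r.
case: k V N x0 nN x0N g gD gZ gN gx0 Nx0 absg => V N x0 nN x0N g gD gZ gN gx0 Nx0 absg.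
  exists g; split=> [a x y||/eqP].
  - by rewrite gD; congr (_ + _); exact: gZ.
  - by exists 1 => v; rewrite mul1r; exact: absg.
  - by rewrite gt_eqF.
pose i : scalar_field R ComplexScalars := Complex 0 1.
(* The functional [g x - i g (i x)] is the complex-linear one whose real part is [g]. *)
exists (fun x => Complex (g x) (- g (i *: x))); split=> [a x y||[]/eqP].
- have gE (z : scalar_field R ComplexScalars) x' :
      g (z *: x') = complex.Re z * g x' + complex.Im z * g (i *: x').
    case: z => c d; rewrite -gZ -gZ -gD scalerA -scalerDl; congr (g (_ *: _)).
    by apply/eqP; rewrite eq_complex /=; apply/andP; split; apply/eqP; ring.
  rewrite scalerDr !gD scalerA (gE a x) (gE (i * a) x).
  case: a => a b.
  by apply/eqP; rewrite eq_complex /=; apply/andP; split; apply/eqP; ring.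
(* Both real and imaginary parts are at most [N v], so the modulus is at most sqrt 2 times [N v];
   the cruder constant 2 avoids the root. *)
- exists 2 => v.
  have -> : rnorm (Complex (g v) (- g (i *: v)) : (scalar_field R ComplexScalars)^o) =
      Num.sqrt (g v ^+ 2 + (- g (i *: v)) ^+ 2) by exact: rnorm_complex.
  have := absg v; have := absg (i *: v).
  case: (nN) => _ _ -> _.
  have -> : rnorm i = 1.
    by rewrite [LHS]rnorm_complex expr0n expr1n add0r sqrtr1.
  rewrite mul1r => h1 h2; rewrite sqrrN.
  have N0 : 0 <= N v by rewrite (le_trans _ h1).
  have -> : 2 * N v = Num.sqrt ((2 * N v) ^+ 2).
    by rewrite sqrtr_sqr ger0_norm// mulr_ge0.
  rewrite ler_sqrt ?sqr_ge0// -(real_normK (num_real (g v))).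
  rewrite -(real_normK (num_real (g (i *: v)))).
  have := normr_ge0 (g v); have := normr_ge0 (g (i *: v)) => h3 h4.
  by nra.
- by rewrite gt_eqF.
Qed.

End SeparatingFunctionals.

(** * Separation in binary tensor products *)

Section ClosedInd.
Variables (K : fieldType) (I : eqType) (X : I -> lmodType K).

Lemma tensor_closed_ind (P : tensor X -> Prop) :
  P 0 -> (forall u v, P u -> P v -> P (u + v)) ->
  (forall a u, P u -> P (a *: u)) -> (forall x, P (pure x)) -> forall u, P u.
Proof.
move=> P0 PD PZ Px; elim/tproj_ind; elim=> [|s IHs t IHt|a s IHs|x].
- exact: P0.
- by rewrite -tproj_add; exact: PD.
- by rewrite -tproj_scale; exact: PZ.
- exact: Px.
Qed.

End ClosedInd.

Section BinaryTensor.
Variables (K : fieldType) (V W E : lmodType K) (B : V -> W -> E).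
Hypothesis Bl : forall w, linear (fun v => B v w).
Hypothesis Br : forall v, linear (B v).

Definition linz2 : tensor2 V W -> E :=
  linz (fun x : forall b, pair_family V W b => B (x false) (x true)).

Lemma bilinear_multilinear :
  multilinear (fun x : forall b, pair_family V W b => B (x false) (x true)).
Proof.
by move=> x [] a y z; rewrite !eqtype.dfwith_in !eqtype.dfwith_out//; [exact: Br|exact: Bl].
Qed.

Lemma linz2_linear : linear linz2.
Proof. exact: linz_linear bilinear_multilinear. Qed.

Lemma linz2_pure v w : linz2 (pure2 v w) = B v w.
Proof. exact: linz_pure bilinear_multilinear. Qed.

End BinaryTensor.

Section BinarySeparation.
Variables (K : fieldType) (V W : lmodType K).

Lemma tensor2_closed_ind (P : tensor2 V W -> Prop) :
  P 0 -> (forall u v, P u -> P v -> P (u + v)) ->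
  (forall a u, P u -> P (a *: u)) -> (forall v w, P (pure2 v w)) -> forall u, P u.
Proof.
move=> P0 PD PZ Pp; apply: tensor_closed_ind => // x.
suff -> : pure x = pure2 (x false) (x true) by exact: Pp.
by congr pure; apply: functional_extensionality_dep => -[].
Qed.

Lemma pure20l (w : W) : pure2 (0 : V) w = 0.
Proof. exact: linear_at0 (pure2_linearl w). Qed.

Lemma pure20r (v : V) : pure2 v (0 : W) = 0.
Proof. exact: linear_at0 (pure2_linearr v). Qed.

Lemma pure2Zl a (v : V) (w : W) : pure2 (a *: v) w = a *: pure2 v w.
Proof. exact: linear_atZ (pure2_linearl w) _ _. Qed.

Lemma pure2Zr a (v : V) (w : W) : pure2 v (a *: w) = a *: pure2 v w.
Proof. exact: linear_atZ (pure2_linearr v) _ _. Qed.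

Lemma pure2Dl (v v' : V) (w : W) : pure2 (v + v') w = pure2 v w + pure2 v' w.
Proof. by have := pure2_linearl w 1 v v'; rewrite !scale1r. Qed.

Lemma pure2Dr (v : V) (w w' : W) : pure2 v (w + w') = pure2 v w + pure2 v w'.
Proof. by have := pure2_linearr v 1 w w'; rewrite !scale1r. Qed.

Lemma tensor2_sum (u : tensor2 V W) :
  exists s : seq (V * W), u = \sum_(x <- s) pure2 x.1 x.2.
Proof.
elim/tensor2_closed_ind: u => [|_ _ [s ->] [t ->]|a _ [s ->]|v w].
- by exists [::]; rewrite big_nil.
- by exists (s ++ t); rewrite big_cat.
- exists [seq (a *: x.1, x.2) | x <- s]; rewrite big_map scaler_sumr.
  by apply: eq_bigr => x _; rewrite pure2Zl.
- by exists [:: (v, w)]; rewrite big_seq1.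
Qed.

Variables (DV : set (V -> K^o)) (DW : set (W -> K^o)).
Hypothesis DVlin : forall f, DV f -> linear f.
Hypothesis DWlin : forall g, DW g -> linear g.
Hypothesis DVsep : forall v, (forall f, DV f -> f v = 0) -> v = 0.
Hypothesis DWsep : forall w, (forall g, DW g -> g w = 0) -> w = 0.

(* If [g w != 0] for the first term [v (x) w], contracting the second factor
   with [g] expresses [v] through the other [v_j], which removes one term. *)
Lemma tensor2_separation (u : tensor2 V W) :
  (forall f g, DV f -> DW g ->
     linz2 (fun v w => f v * g w : K^o) u = 0) -> u = 0.
Proof.
have [s ->] := tensor2_sum u.
have [m] := ubnP (size s); elim: m s => [|m IH] [|[v w] s] //=.
  by rewrite big_nil.
rewrite ltnS => sm H.
have [w0|wN] := pselect (w = 0).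
  move: H; rewrite big_cons /= w0 pure20r add0r; exact: IH.
have [g [Dg gw]] : exists g, DW g /\ g w <> 0.
  apply: contrapT => h; apply: wN; apply: DWsep => g Dg.
  by apply: contrapT => gw; apply: h; exists g.
have lg := DWlin Dg.
have contract : \sum_(x <- (v, w) :: s) g x.2 *: x.1 = 0.
  apply: DVsep => f Df; have lf := DVlin Df; rewrite -[RHS](H _ _ Df Dg).
  have lB : linear (linz2 (fun v w => f v * g w : K^o)).
    apply: linz2_linear => [w' a y z|v' a y z].
      by rewrite lf /GRing.scale/= mulrDl mulrA.
    by rewrite lg /GRing.scale/= mulrDr mulrCA.
  rewrite (linear_at_sum lf) (linear_at_sum lB); apply: eq_bigr => x _.
  rewrite linz2_pure; last 2 first.
  - by move=> w' a y z; rewrite lf /GRing.scale/= mulrDl mulrA.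
  - by move=> v' a y z; rewrite lg /GRing.scale/= mulrDr mulrCA.
  by rewrite (linear_atZ lf) mulrC.
(* Once [v] is eliminated, its coefficients move to the second factor as multiples of [w]. *)
pose s' := [seq (x.1, x.2 - ((g w)^-1 * g x.2) *: w) | x <- s].
suff E : \sum_(x <- (v, w) :: s) pure2 x.1 x.2 = \sum_(x <- s') pure2 x.1 x.2.
  by rewrite E; apply: IH; rewrite ?size_map// -E.
have {contract} vE : v = - \sum_(x <- s) ((g w)^-1 * g x.2) *: x.1.
  under eq_bigr do rewrite -scalerA.
  rewrite -scaler_sumr; apply/eqP; rewrite -addr_eq0; apply/eqP.
  move: contract; rewrite big_cons /= => /(congr1 ( *:%R (g w)^-1)).
  by rewrite scalerDr scaler0 scalerA mulVf ?scale1r//; apply/eqP.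
rewrite big_cons big_map /= {1}vE -scaleN1r pure2Zl.
rewrite (linear_at_sum (pure2_linearl w)) scaler_sumr -big_split /=.
apply: eq_bigr => x _; rewrite pure2Dr addrC; congr (_ + _).
by rewrite -scaleN1r !pure2Zr pure2Zl.
Qed.

End BinarySeparation.

(** * The three-exponent Hoelder inequality *)

Section Exponents.
Variable R : realType.
Implicit Types (s : \bar R) (t : R).

Definition einv s : R := fine s^-1.

Lemma einvE s : (1 <= s)%E -> (s^-1)%E = (einv s)%:E /\ 0 <= einv s.
Proof. by move=> /inve_fin_ge1[x /andP[x0 _]]; rewrite /einv => ->. Qed.

Lemma einv_fin (s : R) : 1 <= s -> einv s%:E = s^-1.
Proof. by move=> s1; rewrite /einv inver gt_eqF// (lt_le_trans ltr01). Qed.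

Lemma einv_pinfty : einv +oo%E = 0.
Proof. by rewrite /einv invey. Qed.

(* The condition [lnorm s a <= t `^ (1 / s)], in a form additive in [t]; at
   [s = +oo] the power [t `^ 0 = 1] no longer depends on [t]. *)
Definition lball s t m (a : 'I_m -> R) : Prop :=
  match s with
  | s%:E => \sum_(i < m) a i `^ s <= t
  | +oo%E => forall i, a i <= 1
  | -oo%E => True
  end.

Lemma lnorm_ge0 s m (a : 'I_m -> R) : 0 <= lnorm s a.
Proof.
case: s => [s||]//=; first exact: powR_ge0.
by elim/big_rec: _ => // i x _ x0; rewrite le_max x0 orbT.
Qed.

Lemma lnorm_le s t m (a : 'I_m -> R) : (1 <= s)%E -> 0 < t ->
  (forall i, 0 <= a i) -> lnorm s a <= t `^ einv s <-> lball s t a.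
Proof.
case: s => [s||] // s1 t0 a0; last first.
  rewrite einv_pinfty powRr0 /=; split=> [/bigmax_leP[_ h] i|h]; first exact: h.
  by apply/bigmax_leP; split=> //; rewrite ler01.
move: s1; rewrite lee_fin => s1; have s0 : 0 < s by apply: lt_le_trans s1.
rewrite einv_fin//=; have S0 : 0 <= \sum_(i < m) a i `^ s.
  by apply: sumr_ge0 => i _; exact: powR_ge0.
have sV0 : 0 < s^-1 by rewrite invr_gt0.
split=> h; last by apply: ge0_ler_powR => //; rewrite ?nnegrE ltW.
rewrite leNgt; apply/negP => lt_tS; move: h; rewrite leNgt => /negP; apply.
by apply: gt0_ltr_powR => //; rewrite nnegrE ltW.
Qed.

Lemma lnormZ s m (a : 'I_m -> R) c : (1 <= s)%E -> 0 <= c ->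
  (forall i, 0 <= a i) -> lnorm s (fun i => c * a i) = c * lnorm s a.
Proof.
case: s => [s||] // s1 c0 a0 /=; last first.
  by elim/big_rec2: _ => [|i y x _ ->]; rewrite ?mulr0// maxr_pMr.
move: s1; rewrite lee_fin => s1; have s0 : 0 < s by apply: lt_le_trans s1.
under eq_bigr do rewrite powRM//.
rewrite -mulr_sumr powRM ?powR_ge0//; last first.
  by apply: sumr_ge0 => i _; exact: powR_ge0.
by rewrite -powRrM divff ?gt_eqF// powRr1.
Qed.

Lemma le_lnorm s m (a b : 'I_m -> R) : (1 <= s)%E ->
  (forall i, 0 <= a i <= b i) -> lnorm s a <= lnorm s b.
Proof.
case: s => [s||] s1 ab; [|rewrite /=|by move: s1]; last first.
  elim/big_rec2: _ => // i y x _ xy; rewrite ge_max !le_max.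
  by have /andP[_ ->] := ab i; rewrite xy orbT.
move: s1; rewrite lee_fin => s1; have s0 : 0 < s by apply: lt_le_trans s1.
have S0 (c : 'I_m -> R) : 0 <= \sum_(i < m) c i `^ s.
  by apply: sumr_ge0 => i _; exact: powR_ge0.
apply: ge0_ler_powR; rewrite ?nnegrE ?invr_ge0 ?(ltW s0)//.
apply: ler_sum => i _; have /andP[a0 aibi] := ab i.
by apply: ge0_ler_powR; rewrite ?nnegrE ?(ltW s0) ?(le_trans a0).
Qed.

Lemma lnorm1 s (a : 'I_1 -> R) : (1 <= s)%E -> 0 <= a ord0 -> lnorm s a = a ord0.
Proof.
case: s => [s||] // s1 a0 /=; rewrite big_ord_recl big_ord0.
  move: s1; rewrite lee_fin => s1; have s0 : 0 < s by apply: lt_le_trans s1.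
  by rewrite addr0 -powRrM divff ?gt_eqF// powRr1.
by apply/max_idPl.
Qed.

Lemma lball_cat s t1 t2 m1 m2 (a : 'I_(m1 + m2) -> R) :
  lball s t1 (a \o @lshift m1 m2) -> lball s t2 (a \o @rshift m1 m2) ->
  lball s (t1 + t2) a.
Proof.
case: s => [s||] //= h1 h2; first by rewrite big_split_ord/= lerD.
by move=> i; case: (split_ordP i) => j ->; [exact: h1|exact: h2].
Qed.

(** The tangent inequality [ln x <= x - 1] at [x = u / M]. The base point [M] is left free so that
    it can become a weighted mean; [u = 0] is separate because it has no logarithm. *)
Lemma powR_le_expR (M u c : R) : 0 < M -> 0 <= u -> 0 <= c ->
  u `^ c <= M `^ c * expR (c * (u / M - 1)).
Proof.
move=> M0; rewrite le_eqVlt => /predU1P[<-|u0] c0.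
  have [->|cN] := eqVneq c 0; last by rewrite powR0// mulr_ge0 ?powR_ge0 ?expR_ge0.
  by rewrite !powRr0 !mul0r expR0 mulr1.
have E : u = M * (u / M) by rewrite mulrCA divff ?gt_eqF// mulr1.
have uM0 : 0 < u / M by rewrite divr_gt0.
rewrite {1}E powRM ?(ltW uM0) ?(ltW M0)//.
rewrite ler_wpM2l ?powR_ge0// /powR gt_eqF// ler_expR ler_wpM2l//.
have := @le_ln1Dx R (u / M - 1); have -> : 1 + (u / M - 1) = u / M by ring.
by apply; rewrite ltrBrDr addNr.
Qed.

(** Pólya's argument: multiply three tangent bounds based at the weighted mean [M]; the powers of
    [M] combine to [M], and the exponents sum to [M / M - 1 = 0]. *)
Lemma weighted_amgm3 (a b c u v w : R) : 0 <= a -> 0 <= b -> 0 <= c ->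
  a + b + c = 1 -> 0 <= u -> 0 <= v -> 0 <= w ->
  u `^ a * v `^ b * w `^ c <= a * u + b * v + c * w.
Proof.
move=> a0 b0 c0 abc u0 v0 w0; set M := _ + _.
have : 0 <= M by rewrite !addr_ge0 ?mulr_ge0.
rewrite le_eqVlt => /predU1P[M0|M0].
  (* If [M = 0], every weighted term vanishes. Since [0^0 = 1], a vanishing weight does not make its
     power vanish; but the weights sum to 1, so some weight is nonzero and its power is 0. *)
  have z (e x : R) : e * x = 0 -> e = 0 \/ x `^ e = 0.
    move=> /eqP; rewrite mulf_eq0 => /orP[/eqP|/eqP->]; first by left.
    by have [->|eN] := eqVneq e 0; [left|right; exact: powR0].
  have au := mulr_ge0 a0 u0; have bv := mulr_ge0 b0 v0; have cw := mulr_ge0 c0 w0.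
  rewrite -M0; have [|a00|->] := z a u; last by rewrite !mul0r.
    by rewrite /M in M0; lra.
  have [|b00|->] := z b v; last by rewrite mulr0 mul0r.
    by rewrite /M in M0; lra.
  have [|c00|->] := z c w; last by rewrite mulr0.
    by rewrite /M in M0; lra.
  by move: abc; rewrite a00 b00 c00 !addr0 => /eqP; rewrite eq_sym oner_eq0.
have MN : M != 0 by rewrite gt_eqF.
have H := ler_pM (mulr_ge0 (powR_ge0 u a) (powR_ge0 v b)) (powR_ge0 w c)
  (ler_pM (powR_ge0 _ _) (powR_ge0 _ _) (powR_le_expR M0 u0 a0)
     (powR_le_expR M0 v0 b0)) (powR_le_expR M0 w0 c0).
have AC (x1 x2 x3 y1 y2 y3 : R) :
  (x1 * y1) * (x2 * y2) * (x3 * y3) = (x1 * x2 * x3) * (y1 * y2 * y3) by ring.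
apply: le_trans H _; rewrite AC -!expRD -!powRD ?MN ?implybT// abc powRr1 ?(ltW M0)//.
suff -> : a * (u / M - 1) + b * (v / M - 1) + c * (w / M - 1) = 0.
  by rewrite expR0 mulr1.
have -> : a * (u / M - 1) + b * (v / M - 1) + c * (w / M - 1) =
  M / M - (a + b + c) by rewrite {4}/M 2!mulrDl; ring.
by rewrite abc divff// subrr.
Qed.

(** The value 1 at [+oo] serves twice: it bounds an entry of the unit ball, as [1^0], and it drops
    out of the sum, where its weight [einv s] is 0. *)
Definition lmass s (x : R) : R := if s is x'%:E then x `^ x' else 1.

Lemma lmass_ge0 s x : 0 <= lmass s x.
Proof. by case: s => [s||] /=; rewrite ?powR_ge0 ?ler01. Qed.

Lemma le_lmass s t m (a : 'I_m -> R) i : (1 <= s)%E -> 0 <= a i ->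
  lball s t a -> a i <= lmass s (a i) `^ einv s.
Proof.
case: s => [s||] //= s1 a0; last by rewrite einv_pinfty powRr0.
move: s1; rewrite lee_fin => s1 _.
by rewrite einv_fin// -powRrM divff ?powRr1// gt_eqF// (lt_le_trans ltr01).
Qed.

Lemma sum_lmass s t m (a : 'I_m -> R) : (1 <= s)%E -> lball s t a ->
  \sum_(i < m) einv s * lmass s (a i) <= einv s * t.
Proof.
case: s => [s||] //= s1 h; rewrite -mulr_sumr; last by rewrite einv_pinfty !mul0r.
by apply: ler_wpM2l => //; have [] := einvE s1.
Qed.

Section Hoelder.
Variables (r s w : \bar R).
Hypotheses (r1 : (1 <= r)%E) (s1 : (1 <= s)%E) (w1 : (1 <= w)%E).
Hypothesis rsw : einv r + einv s + einv w = 1.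

(** AM-GM on each product of three, applied to the masses, with the reciprocal exponents as weights.
    Each family contributes at most its weight times the common [t], and the weights sum to 1. *)
Lemma lball_hoelder t m (x y z : 'I_m -> R) :
  (forall i, 0 <= x i) -> (forall i, 0 <= y i) -> (forall i, 0 <= z i) ->
  lball r t x -> lball s t y -> lball w t z ->
  \sum_(i < m) x i * y i * z i <= t.
Proof.
move=> x0 y0 z0 hx hy hz.
have [_ er] := einvE r1; have [_ es] := einvE s1; have [_ ew] := einvE w1.
apply: (@le_trans _ _ (\sum_(i < m) (einv r * lmass r (x i) +
    einv s * lmass s (y i) + einv w * lmass w (z i)))).
  apply: ler_sum => i _; apply: le_trans (weighted_amgm3 er es ew rsw _ _ _);
    rewrite ?lmass_ge0//.
  apply: ler_pM; rewrite ?mulr_ge0 ?(le_lmass w1 _ hz)//.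
  by apply: ler_pM; rewrite ?(le_lmass r1 _ hx) ?(le_lmass s1 _ hy).
rewrite !big_split/=; have := sum_lmass r1 hx; have := sum_lmass s1 hy.
have := sum_lmass w1 hz => h1 h2 h3.
have -> : t = einv r * t + einv s * t + einv w * t by rewrite -!mulrDl rsw mul1r.
lra.
Qed.

End Hoelder.

(** Provides positive factors, by which one can divide, even when some of [A], [B], [C] vanish. *)
Lemma exists_gt_prod3 (A B C t : R) : 0 <= A -> 0 <= B -> 0 <= C ->
  A * B * C < t ->
  exists A' B' C', [/\ A < A', B < B', C < C' & A' * B' * C' < t].
Proof.
move=> A0 B0 C0 ABC.
(* Adding [e <= 1] to each factor increases the product by at most [e * M]; the 2 in the choice of
   [e] makes the resulting inequality strict. *)
pose M := (A + 1) * (B + 1) + C * (A + B + 1).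
have M0 : 0 < M by rewrite /M; nra.
pose e := Num.min 1 ((t - A * B * C) / (M * 2)).
have e0 : 0 < e by rewrite /e lt_min ltr01 divr_gt0 ?subr_gt0 ?mulr_gt0.
have e1 : e <= 1 by rewrite /e ge_min lexx.
have eM : e * M < t - A * B * C.
  have : e <= (t - A * B * C) / (M * 2) by rewrite /e ge_min lexx orbT.
  by rewrite ler_pdivlMr ?mulr_gt0// => h; nra.
exists (A + e), (B + e), (C + e); split; rewrite ?ltrDl//.
have h1 : (A + e) * (B + e) <= A * B + e * (A + B + 1) by nra.
have h2 : (A + e) * (B + e) <= (A + 1) * (B + 1) by nra.
have -> : (A + e) * (B + e) * (C + e) = (A + e) * (B + e) * C + e * ((A + e) * (B + e)).
  by ring.
have h3 : (A + e) * (B + e) * C <= (A * B + e * (A + B + 1)) * C by rewrite ler_wpM2r.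
have h4 : e * ((A + e) * (B + e)) <= e * ((A + 1) * (B + 1)) by rewrite ler_wpM2l// ltW.
by move: eM; rewrite /M; lra.
Qed.

(** If the sum exceeded [A * B * C], there would be larger positive factors with product still below
    the sum; dividing by them reduces to the unit-ball case [t = 1], a contradiction. *)
Lemma hoelder3 r s w m (x y z : 'I_m -> R) (A B C : R) :
  (1 <= r)%E -> (1 <= s)%E -> (1 <= w)%E -> einv r + einv s + einv w = 1 ->
  (forall i, 0 <= x i) -> (forall i, 0 <= y i) -> (forall i, 0 <= z i) ->
  lnorm r x <= A -> lnorm s y <= B -> lnorm w z <= C ->
  \sum_(i < m) x i * y i * z i <= A * B * C.
Proof.
move=> r1 s1 w1 rsw x0 y0 z0 hA hB hC.
have A0 := le_trans (lnorm_ge0 _ _) hA; have B0 := le_trans (lnorm_ge0 _ _) hB.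
have C0 := le_trans (lnorm_ge0 _ _) hC.
rewrite leNgt; apply/negP => /(exists_gt_prod3 A0 B0 C0)[A' [B' [C' [AA BB CC]]]].
apply/negP; rewrite -leNgt.
have A'0 := le_lt_trans A0 AA; have B'0 := le_lt_trans B0 BB.
have C'0 := le_lt_trans C0 CC.
have nb q (a : 'I_m -> R) D D' : (1 <= q)%E -> 0 < D' -> (forall i, 0 <= a i) ->
    lnorm q a <= D -> D < D' -> lball q 1 (fun i => D'^-1 * a i).
  move=> q1 D0 a0 aD DD; apply/lnorm_le => //.
    by move=> i; rewrite mulr_ge0// invr_ge0 ltW.
  rewrite lnormZ ?invr_ge0 ?(ltW D0)// powR1 ler_pdivrMl// mulr1.
  exact: le_trans (ltW DD).
have := lball_hoelder r1 s1 w1 rsw _ _ _ (nb r x _ _ r1 A'0 x0 hA AA)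
  (nb s y _ _ s1 B'0 y0 hB BB) (nb w z _ _ w1 C'0 z0 hC CC).
have E i : A'^-1 * x i * (B'^-1 * y i) * (C'^-1 * z i) =
    (A' * B' * C')^-1 * (x i * y i * z i) by rewrite !invfM; ring.
under eq_bigr do rewrite E.
rewrite -mulr_sumr ler_pdivrMl ?mulr_gt0// mulr1; apply => i;
  by rewrite mulr_ge0// invr_ge0 ltW.
Qed.

Lemma einv_rexp (p q : \bar R) : (1 <= p)%E -> (1 <= q)%E ->
    (1 <= p^-1 + q^-1)%E ->
  einv (rexp p q) + einv (hoelder_conjugate q) + einv (hoelder_conjugate p) = 1.
Proof.
move=> p1 q1 pq; have [r1 +] := rexpP p1 q1 pq.
have [-> _] := einvE r1; have [-> _] := einvE (hoelder_conj_ge1 p1).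
have [-> _] := einvE (hoelder_conj_ge1 q1).
by rewrite -!EFinD => -[].
Qed.

End Exponents.

(** * Operator norms and linearizations *)

Definition mk_linear (K : fieldType) (U V : lmodType K) (f : U -> V)
    (lf : linear f) : {linear U -> V} :=
  HB.pack f (GRing.isLinear.Build K U V *:%R f lf).

Section OperatorNorm.
Variables (R : realType) (k : scalar_kind).
Local Notation K := (scalar_field R k).

Lemma rnorm_scalar_is_norm : is_norm (fun z : K^o => rnorm z).
Proof.
split=> *; [exact: rnorm_ge0|exact: rnorm0_eq0|exact: rnormM|exact: rnormD].
Qed.

Lemma is_norm0 (V : lmodType K) (N : V -> R) : is_norm N -> N 0 = 0.
Proof. by move=> [_ _ NZ _]; rewrite -(scale0r 0) NZ rnorm0 mul0r. Qed.

Variables (V W : lmodType K) (N : V -> R) (M : W -> R) (f : V -> W).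
Hypotheses (nN : is_norm N) (nM : is_norm M) (lf : linear f).

Lemma opnorm_le c : (forall v, M (f v) <= c * N v) -> 0 <= c -> opnorm N M f <= c.
Proof.
move=> h c0; apply: ge_sup.
  by exists (M (f 0)); exists 0 => //=; rewrite (is_norm0 nN) ler01.
move=> _ [v /= Nv <-]; apply: le_trans (h v) _.
by rewrite -[leRHS]mulr1 ler_wpM2l.
Qed.

Lemma opnorm_ub v : bounded_op N M f -> N v <= 1 -> M (f v) <= opnorm N M f.
Proof.
move=> [c h] v1; apply: ub_le_sup; last by exists v.
(* [bounded_op] leaves the sign of its constant free, hence the absolute value. *)
exists `|c| => _ [w /= w1 <-]; apply: le_trans (h w) _.
case: nN => N0 _ _ _; rewrite -[leRHS]mulr1.
by apply: le_trans (ler_norm _) _; rewrite normrM (ger0_norm (N0 w)) ler_wpM2l.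
Qed.

Lemma opnorm_ge0 : bounded_op N M f -> 0 <= opnorm N M f.
Proof.
move=> bf; case: (nM) => M0 _ _ _; apply: le_trans (M0 (f 0)) _.
by apply: opnorm_ub => //; rewrite (is_norm0 nN) ler01.
Qed.

Lemma opnorm_bound v : bounded_op N M f -> M (f v) <= opnorm N M f * N v.
Proof.
move=> bf; case: (nN) => N0 N00 NZ _; case: (nM) => M0 _ MZ _.
have := N0 v; rewrite le_eqVlt => /predU1P[Nv|Nv].
  by rewrite (N00 v (esym Nv)) (linear_at0 lf) (is_norm0 nN) (is_norm0 nM) mulr0.
have r1 : rnorm (of_real k (N v)^-1) = (N v)^-1.
  by rewrite rnorm_of_real ger0_norm// invr_ge0.
have := @opnorm_ub (of_real k (N v)^-1 *: v) bf.
rewrite (linear_atZ lf) NZ MZ r1 mulVf ?gt_eqF// => /(_ (lexx _)).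
by rewrite ler_pdivrMl// mulrC.
Qed.

Lemma opnorm_le_bounded c : bounded_op N M f -> 0 <= c ->
  opnorm N M f <= c <-> forall v, M (f v) <= c * N v.
Proof.
move=> bf c0; split=> [h v|h]; last exact: opnorm_le.
by apply: le_trans (opnorm_bound _ bf) _; case: (nN) => N0 _ _ _; rewrite ler_wpM2r.
Qed.

End OperatorNorm.

Section LinearizedForms.
Variables (K : fieldType) (I : eqType) (X : I -> lmodType K).

Lemma linz_comp (V W : lmodType K) (f : (forall i, X i) -> V) (g : V -> W) :
  multilinear f -> linear g ->
  multilinear (fun x => g (f x)) /\ linz (fun x => g (f x)) = (fun u => g (linz f u)).
Proof.
move=> mf lg; have lz := linz_linear mf.
have mgf : multilinear (fun x => g (f x)) by move=> x i a y z; rewrite mf lg.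
split=> //; apply/esym/linz_unique => // [a u v|x]; first by rewrite lz lg.
by rewrite linz_pure.
Qed.

Lemma multilinear_zero (V : lmodType K) (f : (forall i, X i) -> V) x i :
  multilinear f -> x i = 0 -> f x = 0.
Proof.
move=> mf xi0; have := mf x i (-1) 0 0; rewrite scaler0 addr0.
have -> : @eqtype.dfwith I (fun j => X j : Type) x i 0 = x.
  apply: functional_extensionality_dep => j.
  by case: eqtype.dfwithP.
by rewrite scaleN1r addNr.
Qed.

Lemma multilinear_scale_coord (V : lmodType K) (f : (forall i, X i) -> V) x i c :
  multilinear f ->
  f (@eqtype.dfwith I (fun j => X j : Type) x i (c *: x i)) = c *: f x.
Proof.
move=> mf; have := mf x i c (x i) 0; rewrite addr0 => ->.
have -> : f (@eqtype.dfwith I (fun j => X j : Type) x i 0) = 0.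
  by apply: (multilinear_zero (i := i)); rewrite ?eqtype.dfwith_in.
rewrite addr0; congr (_ *: f _); apply: functional_extensionality_dep => j.
by case: eqtype.dfwithP.
Qed.

End LinearizedForms.

(** * The norm alpha *)

Section Alpha.
Variables (R : realType) (k : scalar_kind).
Local Notation K := (scalar_field R k).
Variables (p q : \bar R).
Hypotheses (p1 : (1 <= p)%E) (q1 : (1 <= q)%E) (pq : (1 <= p^-1 + q^-1)%E).
Local Notation r := (rexp p q).
Local Notation q' := (hoelder_conjugate q).
Local Notation p' := (hoelder_conjugate p).
Let r_ge1 : (1 <= r)%E := (rexpP p1 q1 pq).1.
Let q'_ge1 : (1 <= q')%E := hoelder_conj_ge1 q1.
Let p'_ge1 : (1 <= p')%E := hoelder_conj_ge1 p1.

Section Representations.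
Variables (n : nat) (X : 'I_n -> completeNormedModType K).
Variables (Y : completeNormedModType K) (beta : tensor X -> R).
Hypotheses (n0 : (0 < n)%N) (nbeta : is_norm beta).
Local Notation XX := (tensor X).

(** The unit ball of the space of forms as a pointwise inequality, which can be checked on
    composites and multiples without computing a supremum. *)
Definition form_ball (phi : (forall i, X i) -> K^o) :=
  multilinear phi /\ forall u, rnorm (linz phi u) <= beta u.

Lemma form_ballE phi :
  (Lbeta beta phi /\ Lbeta_norm beta phi <= 1) <-> form_ball phi.
Proof.
have nK := @rnorm_scalar_is_norm R k.
split=> [[[mphi bphi] h]|[mphi h]].
  split=> // u; rewrite -[leRHS]mul1r; move: u.
  exact/(opnorm_le_bounded nbeta nK (linz_linear mphi) bphi ler01).
have bphi : dual_bounded beta (linz phi) by exists 1 => u; rewrite mul1r.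
split; first by split.
apply/(opnorm_le_bounded nbeta nK (linz_linear mphi) bphi ler01) => u.
by rewrite mul1r.
Qed.

(** Stated for bare functions, so that composites and scalar multiples need no bundled structure. *)
Definition dball (V : normedModType K) (f : V -> K^o) :=
  linear f /\ forall y, rnorm (f y) <= rnorm y.

Lemma dual_ballE (V : normedModType K) (f : {linear V -> K^o}) :
  dual_ball f <-> dball f.
Proof.
have nK := @rnorm_scalar_is_norm R k; have nV := rnorm_is_norm V.
have lf : linear f by exact: linearP.
split=> [[bf h]|[_ h]].
  split=> // u; rewrite -[leRHS]mul1r; move: u.
  exact/(opnorm_le_bounded nV nK lf bf ler01).
have bf : dual_bounded (@rnorm R k V) f by exists 1 => u; rewrite mul1r.
split=> //; apply/(opnorm_le_bounded nV nK lf bf ler01) => u.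
by rewrite mul1r.
Qed.

Lemma form_ball0 : form_ball (fun=> 0).
Proof.
split=> [x i c y z|u]; first by rewrite scaler0 addr0.
have <- : (fun=> 0 : K^o) = linz (fun=> 0 : K^o) :> (XX -> K^o).
  by apply: linz_unique => // [x i c y z|c v w]; rewrite scaler0 addr0.
by rewrite rnorm0; case: nbeta.
Qed.

Lemma dball0 (V : normedModType K) : @dball V (fun=> 0).
Proof. by split=> [c u v|v]; rewrite ?scaler0 ?addr0// rnorm0 rnorm_ge0. Qed.

Definition formdiff m (phi : (forall i, X i) -> K^o) (a b : 'I_m -> XX) (i : 'I_m) :=
  rnorm (linz phi (a i) - linz phi (b i)).

Lemma weak_norm_Sigma_le m (a b : 'I_m -> XX) B :
  weak_norm_Sigma beta q' a b <= B <->
  forall phi, form_ball phi -> lnorm q' (formdiff phi a b) <= B.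
Proof.
split=> [h phi bphi|h].
  apply: le_trans h; apply: ub_le_sup; last first.
    by exists phi => //; apply/form_ballE.
  (* A bound uniform over the ball, which makes the supremum finite; the zero form makes its set
     nonempty. *)
  exists (lnorm q' (fun i => beta (a i - b i))) => _ [psi /form_ballE[mpsi hpsi] <-].
  apply: le_lnorm => // i; rewrite rnorm_ge0 /=.
  by have := hpsi (a i - b i); rewrite (linear_atB (linz_linear mpsi)).
apply: ge_sup; last by move=> _ [phi /form_ballE bphi <-]; exact: h.
exists (lnorm q' (formdiff (fun=> 0) a b)); exists (fun=> 0) => //.
exact/form_ballE/form_ball0.
Qed.

Lemma weak_norm_le m (y : 'I_m -> Y) C :
  weak_norm p' y <= C <->
  forall f, dball f -> lnorm p' (fun i => rnorm (f (y i))) <= C.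
Proof.
split=> [h f bf|h].
  apply: le_trans h; apply: ub_le_sup; last first.
    by exists (mk_linear bf.1) => //; apply/dual_ballE.
  exists (lnorm p' (fun i => rnorm (y i))) => _ [g /dual_ballE[_ hg] <-].
  by apply: le_lnorm => // i; rewrite rnorm_ge0 /=.
apply: ge_sup; last by move=> _ [f /dual_ballE bf <-]; exact: h.
pose z := mk_linear (dball0 Y).1.
exists (lnorm p' (fun i => rnorm (z (y i)))); exists z => //.
exact/dual_ballE/dball0.
Qed.

(** The three factors are bounded separately, since it is their individual sizes that rescaling
    adjusts; suprema are unfolded into inequalities over the unit balls. *)
Definition rep (A B C : R) (u : tensor2 XX Y) := exists m (lam : 'I_m -> K)
    (a b : 'I_m -> XX) (y : 'I_m -> Y),
  [/\ forall i, Sigma (a i) /\ Sigma (b i),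
      u = \sum_(i < m) lam i *: pure2 (a i - b i) (y i),
      lnorm r (fun i => rnorm (lam i)) <= A,
      forall phi, form_ball phi -> lnorm q' (formdiff phi a b) <= B &
      forall f, dball f -> lnorm p' (fun i => rnorm (f (y i))) <= C].

Lemma weak_norm_Sigma_ge0 m (a b : 'I_m -> XX) : 0 <= weak_norm_Sigma beta q' a b.
Proof.
rewrite leNgt; apply/negP => h.
have := (weak_norm_Sigma_le a b _).1 (lexx _) _ form_ball0.
by move=> /le_lt_trans/(_ h); rewrite ltNge lnorm_ge0.
Qed.

Lemma weak_norm_ge0 m (y : 'I_m -> Y) : 0 <= weak_norm p' y.
Proof.
rewrite leNgt; apply/negP => h.
have := (weak_norm_le y _).1 (lexx _) _ (dball0 Y).
by move=> /le_lt_trans/(_ h); rewrite ltNge lnorm_ge0.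
Qed.

Lemma alpha_le_rep A B C u : rep A B C u -> alpha beta p q u <= A * B * C.
Proof.
move=> [m [lam [a [b [y [ab uE hA hB hC]]]]]].
have hB' := (weak_norm_Sigma_le a b B).2 hB; have hC' := (weak_norm_le y C).2 hC.
apply: (@le_trans _ _ (lnorm r (fun i => rnorm (lam i)) *
   weak_norm_Sigma beta q' a b * weak_norm p' y)).
  apply: ge_inf; last by exists m, lam, a, b, y.
  exists 0 => _ [m' [lam' [a' [b' [y' [_ _ ->]]]]]].
  by rewrite !mulr_ge0 ?lnorm_ge0 ?weak_norm_ge0 ?weak_norm_Sigma_ge0.
by rewrite !ler_pM ?mulr_ge0 ?lnorm_ge0 ?weak_norm_ge0 ?weak_norm_Sigma_ge0.
Qed.

Lemma rep_scale A B C (c1 c2 c3 : K) u : rep A B C u ->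
  rep (rnorm c1 * A) (rnorm c2 * B) (rnorm c3 * C) ((c1 * c2 * c3) *: u).
Proof.
move=> [m [lam [a [b [y [ab -> hA hB hC]]]]]].
exists m, (fun i => c1 * lam i), (fun i => c2 *: a i), (fun i => c2 *: b i),
  (fun i => c3 *: y i).
have SigmaZ (v : XX) : Sigma v -> Sigma (c2 *: v).
  (* A single coordinate, available because [n > 0], absorbs the scalar. *)
  move=> [x _ <-]; pose i0 := Ordinal n0.
  exists (@eqtype.dfwith 'I_n (fun j => X j : Type) x i0 (c2 *: x i0)) => //.
  exact: multilinear_scale_coord (@pure_multilinear K 'I_n X).
split=> [i||||].
- by have [sa sb] := ab i; split; exact: SigmaZ.
- rewrite scaler_sumr; apply: eq_bigr => i _.
  rewrite pure2Zr -scalerBr pure2Zl !scalerA; congr (_ *: _); ring.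
- have -> : (fun i => rnorm (c1 * lam i)) = (fun i => rnorm c1 * rnorm (lam i)).
    by apply/funext => i; rewrite rnormM.
  by rewrite lnormZ ?rnorm_ge0// ?ler_wpM2l ?rnorm_ge0// => i; rewrite rnorm_ge0.
- move=> phi bphi; have lz := linz_linear bphi.1.
  have -> : formdiff phi (fun i => c2 *: a i) (fun i => c2 *: b i) =
      (fun i => rnorm c2 * formdiff phi a b i).
    by apply/funext => i; rewrite /formdiff !(linear_atZ lz) -scalerBr -rnormM.
  by rewrite lnormZ ?rnorm_ge0// ?ler_wpM2l ?rnorm_ge0 ?hB// => i; rewrite rnorm_ge0.
- move=> f bf.
  have -> : (fun i => rnorm (f (c3 *: y i))) = (fun i => rnorm c3 * rnorm (f (y i))).
    by apply/funext => i; rewrite (linear_atZ bf.1) -rnormM.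
  by rewrite lnormZ ?rnorm_ge0// ?ler_wpM2l ?rnorm_ge0 ?hC// => i; rewrite rnorm_ge0.
Qed.

Lemma rep_le A B C A' B' C' u : A <= A' -> B <= B' -> C <= C' ->
  rep A B C u -> rep A' B' C' u.
Proof.
move=> AA BB CC [m [lam [a [b [y [ab -> hA hB hC]]]]]].
exists m, lam, a, b, y; split=> //; first exact: le_trans AA.
  by move=> phi bphi; apply: le_trans BB; exact: hB.
by move=> f bf; apply: le_trans CC; exact: hC.
Qed.

Definition balanced t u :=
  rep (t `^ einv r) (t `^ einv q') (t `^ einv p') u.

Lemma balanced_prod t : 0 < t -> t `^ einv r * t `^ einv q' * t `^ einv p' = t.
Proof.
move=> t0; have tN : t != 0 by rewrite gt_eqF.
by rewrite -powRD ?tN ?implybT// -powRD ?tN ?implybT// einv_rexp// powRr1// ltW.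
Qed.

Lemma rep_balanced A B C t u : 0 <= A -> 0 <= B -> 0 <= C -> A * B * C < t ->
  rep A B C u -> balanced t u.
Proof.
move=> A0 B0 C0 /(exists_gt_prod3 A0 B0 C0)[A' [B' [C' [AA BB CC ABC]]]] rABC.
have A'0 := le_lt_trans A0 AA; have B'0 := le_lt_trans B0 BB.
have C'0 := le_lt_trans C0 CC.
have t0 : 0 < t by apply: lt_trans ABC; rewrite !mulr_gt0.
have tE := balanced_prod t0.
set tr := t `^ einv r in tE *; set tq := t `^ einv q' in tE *.
set tp := t `^ einv p' in tE *.
have tr0 : 0 < tr by rewrite powR_gt0.
have tq0 : 0 < tq by rewrite powR_gt0.
have tp0 : 0 < tp by rewrite powR_gt0.
(* The first two scalars bring their factors to the target sizes; the third is forced because the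
   product must be 1 to leave [u] unchanged. The last factor then fits since [A' * B' * C' < t], the
   product of the targets. *)
pose s1 := tr / A'; pose s2 := tq / B'; pose s3 := (s1 * s2)^-1.
have s10 : 0 < s1 by rewrite divr_gt0.
have s20 : 0 < s2 by rewrite divr_gt0.
have s30 : 0 < s3 by rewrite invr_gt0 mulr_gt0.
have := rep_scale (of_real k s1) (of_real k s2) (of_real k s3) rABC.
have s123 : s1 * s2 * s3 = 1 by rewrite /s3 divff// mulf_neq0// gt_eqF.
rewrite -!of_realM s123 of_real1 scale1r.
rewrite !rnorm_of_real !gtr0_norm//; apply: rep_le.
- by rewrite mulrAC ler_pdivrMr// ler_pM2l// ltW.
- by rewrite mulrAC ler_pdivrMr// ler_pM2l// ltW.
- rewrite /s3 ler_pdivrMl ?(mulr_gt0 s10 s20)//; apply: le_trans (ltW CC) _.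
  rewrite -(ler_pM2l (mulr_gt0 A'0 B'0)).
  have -> : A' * B' * (s1 * s2 * tp) = t.
    by rewrite -[RHS]tE /s1 /s2; field; rewrite !gt_eqF.
  exact: ltW.
Qed.

Lemma ord_cat_exists m1 m2 (T : Type) (a : 'I_m1 -> T) (b : 'I_m2 -> T) :
  exists c : 'I_(m1 + m2) -> T,
    (forall i, c (lshift m2 i) = a i) /\ (forall i, c (rshift m1 i) = b i).
Proof.
exists (fun i => match fintype.split i with inl j => a j | inr j => b j end).
split=> i; first by rewrite (unsplitK (inl i : 'I_m1 + 'I_m2)%type).
by rewrite (unsplitK (inr i : 'I_m1 + 'I_m2)%type).
Qed.

Lemma balanced_add t1 t2 u v : 0 < t1 -> 0 < t2 ->
  balanced t1 u -> balanced t2 v -> balanced (t1 + t2) (u + v).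
Proof.
move=> t10 t20 [m1 [l1 [a1 [b1 [y1 [ab1 -> hA1 hB1 hC1]]]]]].
move=> [m2 [l2 [a2 [b2 [y2 [ab2 -> hA2 hB2 hC2]]]]]].
have [l [ll lr]] := ord_cat_exists l1 l2; have [a [al ar]] := ord_cat_exists a1 a2.
have [b [bl br]] := ord_cat_exists b1 b2; have [y [yl yr]] := ord_cat_exists y1 y2.
have t0 := addr_gt0 t10 t20.
exists (m1 + m2)%N, l, a, b, y; split.
- by move=> i; case: (split_ordP i) => j ->; rewrite ?al ?ar ?bl ?br.
- rewrite big_split_ord; congr (_ + _); apply: eq_bigr => i _.
    by rewrite ll al bl yl.
  by rewrite lr ar br yr.
- apply/lnorm_le => // [i|]; first exact: rnorm_ge0.
  apply: lball_cat.
    have -> : (fun i => rnorm (l i)) \o @lshift m1 m2 = fun i => rnorm (l1 i).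
      by apply/funext => i /=; rewrite ll.
    by apply/lnorm_le => // i; exact: rnorm_ge0.
  have -> : (fun i => rnorm (l i)) \o @rshift m1 m2 = fun i => rnorm (l2 i).
    by apply/funext => i /=; rewrite lr.
  by apply/lnorm_le => // i; exact: rnorm_ge0.
- move=> phi bphi; apply/lnorm_le => // [i|]; first exact: rnorm_ge0.
  apply: lball_cat.
    have -> : formdiff phi a b \o @lshift m1 m2 = formdiff phi a1 b1.
      by apply/funext => i /=; rewrite /formdiff al bl.
    by apply/lnorm_le => // [i|]; [exact: rnorm_ge0|exact: hB1].
  have -> : formdiff phi a b \o @rshift m1 m2 = formdiff phi a2 b2.
    by apply/funext => i /=; rewrite /formdiff ar br.
  by apply/lnorm_le => // [i|]; [exact: rnorm_ge0|exact: hB2].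
- move=> f bf; apply/lnorm_le => // [i|]; first exact: rnorm_ge0.
  apply: lball_cat.
    have -> : (fun i => rnorm (f (y i))) \o @lshift m1 m2 = fun i => rnorm (f (y1 i)).
      by apply/funext => i /=; rewrite yl.
    by apply/lnorm_le => // [i|]; [exact: rnorm_ge0|exact: hC1].
  have -> : (fun i => rnorm (f (y i))) \o @rshift m1 m2 = fun i => rnorm (f (y2 i)).
    by apply/funext => i /=; rewrite yr.
  by apply/lnorm_le => // [i|]; [exact: rnorm_ge0|exact: hC2].
Qed.

Lemma rep_pure2 (a b : XX) (y : Y) : Sigma a -> Sigma b ->
  rep 1 (beta (a - b)) (rnorm y) (pure2 (a - b) y).
Proof.
move=> sa sb; exists 1%N, (fun=> 1), (fun=> a), (fun=> b), (fun=> y).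
split=> //.
- by rewrite big_ord_recl big_ord0 addr0 scale1r.
- by rewrite lnorm1 ?rnorm_ge0// rnorm1.
- move=> phi [mphi h]; rewrite lnorm1 ?rnorm_ge0//.
  have := h (a - b).
  by rewrite (linear_atB (linz_linear mphi)).
- by move=> f [_ h]; rewrite lnorm1 ?rnorm_ge0.
Qed.

Lemma Sigma0 : Sigma (0 : XX).
Proof.
exists (fun=> 0) => //; have i0 := Ordinal n0.
exact: (multilinear_zero (i := i0) (@pure_multilinear K 'I_n X)).
Qed.

(** Guarantees that the infimum defining [alpha] runs over a nonempty set. A pure tensor is the
    difference of itself and 0, an element of [Sigma]; sums are handled by balancing, where the
    added 1 provides the strict inequality. *)
Lemma rep_exists u : exists A B C, [/\ 0 <= A, 0 <= B, 0 <= C & rep A B C u].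
Proof.
have beta0 v : 0 <= beta v by case: nbeta.
pose P u := exists A B C, [/\ 0 <= A, 0 <= B, 0 <= C & rep A B C u].
have PD v w : P v -> P w -> P (v + w).
  move=> [A [B [C [A0 B0 C0 rv]]]] [A' [B' [C' [A'0 B'0 C'0 rw]]]].
  pose t := A * B * C + 1; pose t' := A' * B' * C' + 1.
  have t0 : 0 < t by rewrite ltr_wpDl// !mulr_ge0.
  have t'0 : 0 < t' by rewrite ltr_wpDl// !mulr_ge0.
  have bv : balanced t v by apply: rep_balanced rv => //; rewrite ltrDl.
  have bw : balanced t' w by apply: rep_balanced rw => //; rewrite ltrDl.
  do 3 eexists; split; last exact: balanced_add bv bw; exact: powR_ge0.
have PZ (c : K) v : P v -> P (c *: v).
  move=> [A [B [C [A0 B0 C0 rv]]]]; exists (rnorm c * A), B, C.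
  split=> //; first by rewrite mulr_ge0 ?rnorm_ge0.
  by have := rep_scale c 1 1 rv; rewrite !mulr1 rnorm1 !mul1r.
have Pp x (y : Y) : P (pure2 (pure x) y).
  have := @rep_pure2 (pure x) 0 y (ex_intro2 _ _ x I erefl) Sigma0.
  rewrite subr0 => h; exists 1, (beta (pure x)), (rnorm y).
  by split; rewrite ?ler01 ?rnorm_ge0.
have P0 : P 0.
  by rewrite -(scale0r (pure2 (pure (fun=> 0)) 0)); apply: PZ; exact: Pp.
elim/tensor2_closed_ind: u => // v y.
elim/tensor_closed_ind: v => [|v w Pv Pw|c v Pv|x]; last exact: Pp.
- by rewrite pure20l.
- by rewrite pure2Dl; exact: PD.
- by rewrite pure2Zl; exact: PZ.
Qed.

(** All lower bounds on [alpha] are read off representations through this. When [c = 0] division is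
    impossible, and one existing representation suffices. *)
Lemma le_mul_alpha c d u : 0 <= c ->
  (forall A B C, 0 <= A -> 0 <= B -> 0 <= C -> rep A B C u -> d <= c * (A * B * C)) ->
  d <= c * alpha beta p q u.
Proof.
rewrite le_eqVlt => /predU1P[<-|c0] h.
  by have [A [B [C [A0 B0 C0 ru]]]] := rep_exists u; have := h _ _ _ A0 B0 C0 ru; rewrite !mul0r.
rewrite -ler_pdivrMl//; apply: lb_le_inf.
  have [_ [_ [_ [_ _ _ [m [lam [a [b [y [ab uE _ _ _]]]]]]]]]] := rep_exists u.
  by eexists; exists m, lam, a, b, y; split.
move=> _ [m [lam [a [b [y [ab uE ->]]]]]]; rewrite ler_pdivrMl//.
apply: h; rewrite ?lnorm_ge0 ?weak_norm_ge0 ?weak_norm_Sigma_ge0//.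
exists m, lam, a, b, y; split=> //.
  exact/weak_norm_Sigma_le.
exact/weak_norm_le.
Qed.

(** Dividing [phi] by [c] puts it into the unit ball; for [c = 0] it vanishes on all the
    differences. *)
Lemma formdiff_le m (a b : 'I_m -> XX) B c phi :
  (forall psi, form_ball psi -> lnorm q' (formdiff psi a b) <= B) ->
  multilinear phi -> 0 <= c -> (forall u, rnorm (linz phi u) <= c * beta u) ->
  lnorm q' (formdiff phi a b) <= c * B.
Proof.
move=> hB mphi c0 h.
have lz := linz_linear mphi.
move: c0; rewrite le_eqVlt => /predU1P[c0|c0].
  (* Written as a product so that [lnormZ] evaluates the norm of the zero sequence. *)
  have -> : formdiff phi a b = fun i => 0 * 0.
    apply/funext => i; apply/eqP; rewrite mul0r eq_le rnorm_ge0 andbT.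
    have := h (a i - b i); rewrite -c0 mul0r.
    by rewrite (linear_atB lz).
  by rewrite lnormZ// -c0 !mul0r.
pose d := of_real k c^-1.
have ld : linear (fun z : K^o => d *: z : K^o).
  by move=> e x y; rewrite scalerDr !scalerA mulrC.
have [md lzd] := linz_comp mphi ld.
have rd : rnorm d = c^-1 by rewrite rnorm_of_real ger0_norm// invr_ge0 ltW.
have := hB (fun x => d *: phi x).
have -> : formdiff (fun x => d *: phi x) a b = (fun i => c^-1 * formdiff phi a b i).
  by apply/funext => i; rewrite /formdiff lzd -scalerBr -rd -rnormM.
rewrite lnormZ ?invr_ge0 ?(ltW c0)//; last by move=> i; exact: rnorm_ge0.
rewrite ler_pdivrMl//; apply; split=> // u.
by rewrite lzd [leLHS]rnormM rd ler_pdivrMl.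
Qed.

Lemma dual_le m (y : 'I_m -> Y) (C c : R) (f : Y -> K^o) :
  (forall g, dball g -> lnorm p' (fun i => rnorm (g (y i))) <= C) ->
  linear f -> 0 <= c -> (forall v, rnorm (f v) <= c * rnorm v) ->
  lnorm p' (fun i => rnorm (f (y i))) <= c * C.
Proof.
move=> hC lf c0 h.
move: c0; rewrite le_eqVlt => /predU1P[c0|c0].
  have -> : (fun i => rnorm (f (y i))) = fun i => 0 * 0.
    apply/funext => i; apply/eqP; rewrite mul0r eq_le rnorm_ge0 andbT.
    by have := h (y i); rewrite -c0 mul0r.
  by rewrite lnormZ// -c0 !mul0r.
pose d := of_real k c^-1.
have rd : rnorm d = c^-1 by rewrite rnorm_of_real ger0_norm// invr_ge0 ltW.
have := hC (fun v => d *: f v).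
have -> : (fun i => rnorm (d *: f (y i))) = (fun i => c^-1 * rnorm (f (y i))).
  by apply/funext => i; rewrite -rd -rnormM.
rewrite lnormZ ?invr_ge0 ?(ltW c0)//; last by move=> i; exact: rnorm_ge0.
rewrite ler_pdivrMl//; apply; split=> [e u v|u].
  by rewrite lf scalerDr !scalerA mulrC.
by rewrite [leLHS]rnormM rd ler_pdivrMl.
Qed.

Lemma rep_functional_bound A B C u (phi : (forall i, X i) -> K^o)
    (f : Y -> K^o) (c1 c2 : R) :
  rep A B C u ->
  multilinear phi -> linear f -> 0 <= c1 -> 0 <= c2 ->
  (forall v, rnorm (linz phi v) <= c1 * beta v) ->
  (forall y, rnorm (f y) <= c2 * rnorm y) ->
  rnorm (linz2 (fun v y => linz phi v * f y : K^o) u) <= c1 * c2 * (A * B * C).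
Proof.
move=> [m [lam [a [b [y [ab -> hA hB hC]]]]]] mphi lf c10 c20 hphi hf.
have lz := linz_linear mphi.
have Bl w : linear (fun v => linz phi v * f w : K^o).
  by move=> e x z; rewrite lz /GRing.scale/= mulrDl mulrA.
have Br v : linear (fun w => linz phi v * f w : K^o).
  by move=> e x z; rewrite lf /GRing.scale/= mulrDr mulrCA.
have lF := linz2_linear Bl Br.
rewrite (linear_at_sum lF); apply: le_trans (rnorm_sum _ _ _) _.
have -> : c1 * c2 * (A * B * C) = A * (c1 * B) * (c2 * C) by ring.
apply: (@le_trans _ _ (\sum_(i < m) rnorm (lam i) * formdiff phi a b i * rnorm (f (y i)))).
  apply: ler_sum => i _; rewrite (linear_atZ lF) linz2_pure//.
  by rewrite [leLHS]rnormM [X in _ * X]rnormM mulrA /formdiff (linear_atB lz).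
apply: (hoelder3 r_ge1 q'_ge1 p'_ge1) => //.
- exact: einv_rexp.
- by move=> i; exact: rnorm_ge0.
- by move=> i; exact: rnorm_ge0.
- by move=> i; exact: rnorm_ge0.
- exact: formdiff_le.
- exact: dual_le.
Qed.

Lemma alpha_functional_bound u (phi : (forall i, X i) -> K^o)
    (f : Y -> K^o) (c1 c2 : R) :
  multilinear phi -> linear f -> 0 <= c1 -> 0 <= c2 ->
  (forall v, rnorm (linz phi v) <= c1 * beta v) ->
  (forall y, rnorm (f y) <= c2 * rnorm y) ->
  rnorm (linz2 (fun v y => linz phi v * f y : K^o) u) <= c1 * c2 * alpha beta p q u.
Proof.
move=> *; apply: le_mul_alpha => [|*]; first exact: mulr_ge0.
exact: rep_functional_bound.
Qed.

(** * The norm axioms for [alpha] *)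

Implicit Types u v : tensor2 XX Y.

Lemma alpha_ge0 u : 0 <= alpha beta p q u.
Proof.
by rewrite -[leRHS]mul1r; apply: le_mul_alpha => // *; rewrite mul1r !mulr_ge0.
Qed.

Lemma alphaZ_le c u : alpha beta p q (c *: u) <= rnorm c * alpha beta p q u.
Proof.
apply: le_mul_alpha => [|A B C A0 B0 C0 ru]; first exact: rnorm_ge0.
have := alpha_le_rep (rep_scale c 1 1 ru).
by rewrite !mulr1 rnorm1 !mul1r !mulrA.
Qed.

Lemma alphaD u v : alpha beta p q (u + v) <= alpha beta p q u + alpha beta p q v.
Proof.
rewrite -lerBlDr -[leRHS]mul1r; apply: le_mul_alpha => // A B C A0 B0 C0 ru.
rewrite mul1r lerBlDr -lerBlDl -[leRHS]mul1r.
apply: le_mul_alpha => // A' B' C' A'0 B'0 C'0 rv.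
rewrite mul1r lerBlDl; apply/ler_addgt0Pr => e e0.
(* Balancing needs strict inequalities; the two halves of [e] pay for them. *)
pose t := A * B * C + e / 2; pose t' := A' * B' * C' + e / 2.
have e20 : 0 < e / 2 by rewrite divr_gt0.
have t0 : 0 < t by rewrite ltr_wpDl// !mulr_ge0.
have t'0 : 0 < t' by rewrite ltr_wpDl// !mulr_ge0.
have bu : balanced t u by apply: rep_balanced ru => //; rewrite ltrDl.
have bv : balanced t' v by apply: rep_balanced rv => //; rewrite ltrDl.
apply: le_trans (alpha_le_rep (balanced_add t0 t'0 bu bv)) _.
by rewrite (balanced_prod (addr_gt0 t0 t'0)) addrACA -splitr.
Qed.

Lemma alpha_eq0 u : alpha beta p q u = 0 -> u = 0.
Proof.
move=> u0.
apply: (@tensor2_separation _ _ _ [set f | linear f /\ dual_bounded beta f]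
  [set f | linear f /\ dual_bounded (@rnorm R k Y) f]).
- by move=> f [].
- by move=> f [].
- move=> v h; apply: contrapT => /(norm_separates nbeta)[f [lf bf]]; apply.
  exact: h.
- move=> y h; apply: contrapT => /(norm_separates (rnorm_is_norm Y))[f [lf bf]]; apply.
  exact: h.
move=> F f [lF [c1 hF]] [lf [c2 hf]].
have mphi := linear_multilinear lF.
(* Hahn-Banach yields a functional on the tensor product, while the Hoelder bound speaks of
   multilinear forms; the two are matched here. *)
have FE : F = linz (fun x => F (pure x)) by exact: linz_unique.
apply: rnorm0_eq0; apply/eqP; rewrite eq_le rnorm_ge0 andbT FE.
have := @alpha_functional_bound u _ f `|c1| `|c2| mphi lf (normr_ge0 _) (normr_ge0 _).
rewrite u0 mulr0; apply.
  move=> v; rewrite -FE; apply: le_trans (hF v) _.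
  by case: nbeta => b0 _ _ _; rewrite ler_wpM2r// ler_norm.
by move=> y; apply: le_trans (hf y) _; rewrite ler_wpM2r ?rnorm_ge0// ler_norm.
Qed.

Lemma alpha_is_norm : is_norm (alpha (Y := Y) beta p q).
Proof.
split; [exact: alpha_ge0|exact: alpha_eq0| |exact: alphaD].
move=> c u; apply/eqP; rewrite eq_le alphaZ_le /=.
have [->|cN] := eqVneq c 0; first by rewrite rnorm0 mul0r alpha_ge0.
have c0 : 0 < rnorm c.
  rewrite lt_neqAle rnorm_ge0 andbT eq_sym; apply/eqP => /rnorm0_eq0/eqP.
  by rewrite (negbTE cN).
(* The reverse inequality is the proved one for the inverse scalar applied to the multiple
   [c *: u]. *)
have := alphaZ_le c^-1 (c *: u); rewrite scalerA mulVf// scale1r.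
have -> : rnorm c^-1 = (rnorm c)^-1.
  by apply: (mulfI (negbT (gt_eqF c0))); rewrite -rnormM (divff cN) rnorm1 divff// gt_eqF.
by rewrite ler_pdivlMl.
Qed.

Lemma alpha_pure2_le (a b : XX) (y : Y) : Sigma a -> Sigma b ->
  alpha beta p q (pure2 (a - b) y) <= beta (a - b) * rnorm y.
Proof. by move=> sa sb; have := alpha_le_rep (rep_pure2 y sa sb); rewrite mul1r. Qed.

End Representations.
End Alpha.

(** * Induced functionals and tensor maps *)

Lemma alpha_dual_norm_bounds (R : realType) (k : scalar_kind) (p q : \bar R)
    (n : nat) (X : 'I_n -> completeNormedModType (scalar_field R k))
    (Y : completeNormedModType (scalar_field R k)) (beta : tensor X -> R)
    (phi : (forall i, X i) -> (scalar_field R k)^o)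
    (f : {linear Y -> (scalar_field R k)^o}) :
  (0 < n)%N -> (1 <= p)%E -> (1 <= q)%E -> (1 <= p^-1 + q^-1)%E ->
  is_norm beta -> Lbeta beta phi -> dual_bounded (@rnorm R k Y) f ->
  exists F : {linear tensor2 (tensor X) Y -> (scalar_field R k)^o},
    [/\ forall x y, F (pure2 (pure x) y) = linz phi (pure x) * f y,
        dual_bounded (alpha beta p q) F,
        Lip beta phi * dual_norm (@rnorm R k Y) f <=
          dual_norm (alpha beta p q) F &
        dual_norm (alpha beta p q) F <=
          Lbeta_norm beta phi * dual_norm (@rnorm R k Y) f].
Proof.
move=> n0 p1 q1 pq nbeta [mphi bphi] bf.
have nK := @rnorm_scalar_is_norm R k; have nY := rnorm_is_norm Y.
have nalpha := alpha_is_norm p1 q1 pq Y n0 nbeta.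
have lz := linz_linear mphi; have lf : linear f := linearP f.
have Bl w : linear (fun v => linz phi v * f w : (scalar_field R k)^o).
  by move=> e x z; rewrite lz /GRing.scale/= mulrDl mulrA.
have Br v : linear (fun w => linz phi v * f w : (scalar_field R k)^o).
  by move=> e x z; rewrite lf /GRing.scale/= mulrDr mulrCA.
pose F := mk_linear (linz2_linear Bl Br).
have FE v y : F (pure2 v y) = linz phi v * f y by exact: linz2_pure.
have N0 := opnorm_ge0 nbeta nK bphi; have f0 := opnorm_ge0 nY nK bf.
have Fle u : rnorm (F u) <= Lbeta_norm beta phi * dual_norm (@rnorm R k Y) f *
    alpha beta p q u.
  apply: (alpha_functional_bound p1 q1 pq n0 nbeta u mphi lf N0 f0) => [v|y].
    exact: (opnorm_bound nbeta nK lz v bphi).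
  exact: (opnorm_bound nY nK lf y bf).
have bF : dual_bounded (alpha beta p q) F.
  by exists (Lbeta_norm beta phi * dual_norm (@rnorm R k Y) f).
have F0 := opnorm_ge0 nalpha nK bF.
exists F; split=> //; last first.
  by apply: opnorm_le => //; exact: mulr_ge0.
have lF : linear F := linearP F.
move: f0; rewrite -/(dual_norm _ f) le_eqVlt => /predU1P[<-|f0]; first by rewrite mulr0.
(* The quotient of the norms of [F] and [f] is shown to be a Lipschitz constant: testing [F] on
   [(a - b)] tensor [y], where [alpha] is at most [beta (a - b) * rnorm y], bounds [rnorm (f y)] for
   every [y], hence the norm of [f]. *)
rewrite -ler_pdivlMr//; apply: ge_inf; first by exists 0 => L [].
split=> [|a b sa sb]; first by rewrite divr_ge0// ltW.
rewrite -(linear_atB lz) mulrAC ler_pdivlMr//.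
set c := rnorm (linz phi (a - b)).
have : 0 <= c := rnorm_ge0 _.
rewrite le_eqVlt => /predU1P[<-|c0].
  by rewrite mul0r mulr_ge0//; case: nbeta.
rewrite -ler_pdivlMl//; apply: opnorm_le => // [y|]; last first.
  by rewrite mulr_ge0 ?invr_ge0 ?(ltW c0)// mulr_ge0//; case: nbeta.
rewrite -mulrA ler_pdivlMl// -rnormM -FE -mulrA.
apply: le_trans (opnorm_bound nalpha nK lF _ bF) _.
by rewrite ler_wpM2l// alpha_pure2_le.
Qed.

Lemma alpha_tensor_map (R : realType) (k : scalar_kind) (p q : \bar R) (n : nat)
    (X Z : 'I_n -> completeNormedModType (scalar_field R k))
    (Y W : completeNormedModType (scalar_field R k))
    (beta : tensor X -> R) (theta : tensor Z -> R)
    (T : (forall i, Z i) -> tensor X) (S : {linear W -> Y}) :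
  (0 < n)%N -> (1 <= p)%E -> (1 <= q)%E -> (1 <= p^-1 + q^-1)%E ->
  is_norm beta -> is_norm theta -> multilinear T ->
  bounded_op theta beta (linz T) ->
  linz T @` (@Sigma R k n Z) `<=` @Sigma R k n X ->
  bounded_op (@rnorm R k W) (@rnorm R k Y) S ->
  exists F : {linear tensor2 (tensor Z) W -> tensor2 (tensor X) Y},
    [/\ forall z w, F (pure2 (pure z) w) = pure2 (linz T (pure z)) (S w),
        bounded_op (alpha theta p q) (alpha beta p q) F &
        opnorm (alpha theta p q) (alpha beta p q) F <=
          opnorm theta beta (linz T)
          * opnorm (@rnorm R k W) (@rnorm R k Y) S].
Proof.
move=> n0 p1 q1 pq nbeta ntheta mT bT TS bS.
have nW := rnorm_is_norm W; have nY := rnorm_is_norm Y.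
have lT := linz_linear mT; have lS : linear S := linearP S.
have Bl w : linear (fun v => pure2 (linz T v) (S w)).
  by move=> e x z; rewrite lT pure2_linearl.
have Br v : linear (fun w => pure2 (linz T v) (S w)).
  by move=> e x z; rewrite lS pure2_linearr.
pose F := mk_linear (linz2_linear Bl Br).
have FE v w : F (pure2 v w) = pure2 (linz T v) (S w) by exact: linz2_pure.
have lF : linear F := linearP F.
have T0 := opnorm_ge0 ntheta nbeta bT; have S0 := opnorm_ge0 nW nY bS.
have Tb u := opnorm_bound ntheta nbeta lT u bT.
have Sb w := opnorm_bound nW nY lS w bS.
set t := opnorm theta beta (linz T) in T0 Tb *.
set s := opnorm (@rnorm R k W) (@rnorm R k Y) S in S0 Sb *.
(* A representation is pushed forward term by term with the same coefficients. It stays admissible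
   because [T] maps [Sigma] into [Sigma]; its weak norms are controlled by pulling forms back along
   [T] and functionals along [S], at the cost of [t] and [s]. *)
have Frep A B C u : rep p q theta A B C u ->
    rep p q beta A (t * B) (s * C) (F u).
  move=> [m [lam [a [b [w [ab -> hA hB hC]]]]]].
  exists m, lam, (fun i => linz T (a i)), (fun i => linz T (b i)), (fun i => S (w i)).
  split=> //.
  - by move=> i; have [sa sb] := ab i; split; apply: TS; [exists (a i)|exists (b i)].
  - rewrite (linear_at_sum lF); apply: eq_bigr => i _.
    by rewrite (linear_atZ lF) FE (linear_atB lT).
  - move=> phi [mphi hphi]; have [mpT lpT] := linz_comp mT (linz_linear mphi).
    have -> : formdiff phi (fun i => linz T (a i)) (fun i => linz T (b i)) =
        formdiff (fun z => linz phi (T z)) a b.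
      by apply/funext => i; rewrite /formdiff lpT.
    apply: (formdiff_le q1 hB mpT T0) => v.
    by rewrite lpT; exact: le_trans (hphi _) (Tb v).
  - move=> f [lf hf].
    apply: (dual_le p1 (f := fun w => f (S w)) hC _ S0) => [e x z|v].
      by rewrite lS lf.
    exact: le_trans (hf _) (Sb v).
have Fle u : alpha beta p q (F u) <= t * s * alpha theta p q u.
  apply: (le_mul_alpha p1 q1 pq n0 ntheta) => [|A B C A0 B0 C0 ru].
    exact: mulr_ge0.
  apply: le_trans (alpha_le_rep p1 q1 nbeta (Frep _ _ _ _ ru)) _.
  by rewrite le_eqVlt; apply/orP; left; apply/eqP; ring.
exists F; split=> //; first by exists (t * s).
apply: opnorm_le => //; last exact: mulr_ge0.
exact: (alpha_is_norm p1 q1 pq W n0 ntheta).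
Qed.

Theorem proposition4p6 (R : realType) (k : scalar_kind) (p q : \bar R)
    (n : nat) (X : 'I_n -> completeNormedModType (scalar_field R k))
    (Y : completeNormedModType (scalar_field R k)) (beta : tensor X -> R) :
  (0 < n)%N ->
  (1 <= p)%E -> (1 <= q)%E -> (1 <= p^-1 + q^-1)%E ->
  reasonable_crossnorm beta ->
  [/\ is_norm (alpha (Y := Y) beta p q),
      forall (a b : tensor X) (y : Y), Sigma a -> Sigma b ->
        alpha beta p q (pure2 (a - b) y) <= beta (a - b) * rnorm y,
      forall (phi : (forall i, X i) -> (scalar_field R k)^o)
             (f : {linear Y -> (scalar_field R k)^o}),
        Lbeta beta phi -> dual_bounded (@rnorm R k Y) f ->
        exists F : {linear tensor2 (tensor X) Y -> (scalar_field R k)^o},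
          [/\ forall x y, F (pure2 (pure x) y) = linz phi (pure x) * f y,
              dual_bounded (alpha beta p q) F,
              Lip beta phi * dual_norm (@rnorm R k Y) f <=
                dual_norm (alpha beta p q) F &
              dual_norm (alpha beta p q) F <=
                Lbeta_norm beta phi * dual_norm (@rnorm R k Y) f] &
      forall (Z : 'I_n -> completeNormedModType (scalar_field R k))
             (W : completeNormedModType (scalar_field R k)) (theta : tensor Z -> R)
             (T : (forall i, Z i) -> tensor X) (S : {linear W -> Y}),
        reasonable_crossnorm theta ->
        multilinear T ->
        (exists C : R, forall z, beta (T z) <= C * \prod_(i < n) rnorm (z i)) ->
        bounded_op theta beta (linz T) ->
        linz T @` (@Sigma R k n Z) `<=` @Sigma R k n X ->
        bounded_op (@rnorm R k W) (@rnorm R k Y) S ->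
        exists F : {linear tensor2 (tensor Z) W -> tensor2 (tensor X) Y},
          [/\ forall z w, F (pure2 (pure z) w) = pure2 (linz T (pure z)) (S w),
              bounded_op (alpha theta p q) (alpha beta p q) F &
              opnorm (alpha theta p q) (alpha beta p q) F <=
                opnorm theta beta (linz T)
                * opnorm (@rnorm R k W) (@rnorm R k Y) S]].

Proof.
move=> n0 p1 q1 pq [nbeta _]; split.
- exact: alpha_is_norm.
- by move=> a b y; exact: alpha_pure2_le.
- by move=> phi f; exact: alpha_dual_norm_bounds.
- move=> Z W theta T S [ntheta _] mT _; exact: alpha_tensor_map.
Qed.
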